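(* All strongly normalising $\lambda_{\circledR}$-terms are typeable in the system $\lambda_{\circledR}\cap$.
   Context: TERMS. Fix a denumerable set of term variables. Pre-terms: $f ::= x \mid \lambda x.f \mid f\,f \mid x\odot f \mid x<^{x_1}_{x_2} f$ (variable, abstraction, application, weakening, contraction). $\lambda x.f$ binds $x$ in $f$; $x<^{x_1}_{x_2}f$ binds $x_1,x_2$ in $f$ and introduces the free variable $x$; contraction is insensitive to the order of $x_1,x_2$. Free variables: $Fv(x)=\{x\}$, $Fv(\lambda x.f)=Fv(f)\setminus\{x\}$, $Fv(fg)=Fv(f)\cup Fv(g)$, $Fv(x\odot f)=\{x\}\cup Fv(f)$, $Fv(x<^{x_1}_{x_2}f)=\{x\}\cup(Fv(f)\setminus\{x_1,x_2\})$. The set $\Lambda_{\circledR}$ of $\lambda_{\circledR}$-terms is the smallest set of pre-terms such that: $x\in\Lambda_{\circledR}$; $\lambda x.f\in\Lambda_{\circledR}$ if $f\in\Lambda_{\circledR}$, $x\in Fv(f)$; $fg\in\Lambda_{\circledR}$ if $f,g\in\Lambda_{\circledR}$, $Fv(f)\cap Fv(g)=\emptyset$; $x\odot f\in\Lambda_{\circledR}$ if $f\in\Lambda_{\circledR}$, $x\notin Fv(f)$; $x<^{x_1}_{x_2}f\in\Lambda_{\circledR}$ if $f\in\Lambda_{\circledR}$, $x_1\ne x_2$, $x_1,x_2\in Fv(f)$, $x\notin Fv(f)\setminus\{x_1,x_2\}$. Only such terms are considered throughout (well-formedness is always implicitly assumed), up to renaming of bound variables and with Barendregt's convention. For lists of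 distinct variables, $X\odot M$ is $x_1\odot\cdots x_n\odot M$ and $X<^Y_Z M$ is $x_1<^{y_1}_{z_1}\cdots x_n<^{y_n}_{z_n}M$ (both are $M$ if $n=0$); the same notation is used for finite sets. SUBSTITUTION. $M[N/x]$ is defined when $x\in Fv(M)$ and $(Fv(M)\setminus\{x\})\cap Fv(N)=\emptyset$ by: $x[N/x]=N$; $(\lambda y.M)[N/x]=\lambda y.M[N/x]$ ($x\ne y$); $(MP)[N/x]=M[N/x]P$ if $x\notin Fv(P)$; $(MP)[N/x]=M\,P[N/x]$ if $x\notin Fv(M)$; $(y\odot M)[N/x]=y\odot M[N/x]$ ($x\neq y$); $(x\odot M)[N/x]=Fv(N)\odot M$; $(y<^{y_1}_{y_2}M)[N/x]=y<^{y_1}_{y_2}M[N/x]$ ($x\ne y$); $(x<^{x_1}_{x_2}M)[N/x]=Fv(N)<^{Fv(N_1)}_{Fv(N_2)}M[N_1/x_1,N_2/x_2]$, where $N_1,N_2$ are obtained from $N$ by renaming all its free variables by fresh ones and $M[N_1/x_1,N_2/x_2]=(M[N_1/x_1])[N_2/x_2]$. REDUCTION. $\to$ is the closure under term contexts of: $(\beta)$ $(\lambda x.M)N\to M[N/x]$; $(\gamma_1)$ $x<^{x_1}_{x_2}(\lambda y.M)\to\lambda y.x<^{x_1}_{x_2}M$; $(\gamma_2)$ $x<^{x_1}_{x_2}(MN)\to(x<^{x_1}_{x_2}M)N$ if $x_1,x_2\notin Fv(N)$; $(\gamma_3)$ $x<^{x_1}_{x_2}(MN)\to M(x<^{x_1}_{x_2}N)$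 if $x_1,x_2\notin Fv(M)$; $(\omega_1)$ $\lambda x.(y\odot M)\to y\odot(\lambda x.M)$, $x\ne y$; $(\omega_2)$ $(x\odot M)N\to x\odot(MN)$; $(\omega_3)$ $M(x\odot N)\to x\odot(MN)$; $(\gamma\omega_1)$ $x<^{x_1}_{x_2}(y\odot M)\to y\odot(x<^{x_1}_{x_2}M)$, $y\ne x_1,x_2$; $(\gamma\omega_2)$ $x<^{x_1}_{x_2}(x_1\odot M)\to M[x/x_2]$. One works modulo the congruence $\equiv$ generated by: $x\odot(y\odot M)\equiv y\odot(x\odot M)$; $x<^{x_1}_{x_2}M\equiv x<^{x_2}_{x_1}M$; $x<^{y}_{z}(y<^{u}_{v}M)\equiv x<^{y}_{u}(y<^{z}_{v}M)$; $x<^{x_1}_{x_2}(y<^{y_1}_{y_2}M)\equiv y<^{y_1}_{y_2}(x<^{x_1}_{x_2}M)$ for $x\neq y_1,y_2$, $y\ne x_1,x_2$. A term is strongly normalising if it admits no infinite reduction sequence; equivalently, the set $\mathcal{SN}$ of strongly normalising terms is the smallest set containing a term whenever it contains all its one-step reducts. TYPES AND TYPING. Strict types $\sigma ::= p\mid\alpha\to\sigma$ ($p$ a type atom from a denumerable set); types $\alpha ::= \cap_i^n\sigma_i=\sigma_1\cap\dots\cap\sigma_n$, $n\ge0$; for $n=0$ this is the neutral element $\top$ of $\cap$. $\cap$ is idempotent, commutative and associative. A basis $\Gamma$ is a finite set $\{x_1:\alpha_1,\dots,x_n:\alpha_n\}$ with distinct variables, $Dom(\Gamma)=\{x_1,\dots,x_n\}$;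 a comma denotes union of bases with disjoint domains; $\Gamma\sqcap\Delta=\{x:\alpha\cap\beta\mid x:\alpha\in\Gamma,\ x:\beta\in\Delta\}$ for $Dom(\Gamma)=Dom(\Delta)$; $\Gamma^\top=\{x:\top\mid x\in Dom(\Gamma)\}$; $\sqcap$ binds tighter than comma. The rules of $\lambda_{\circledR}\cap$ are: $(Ax)$ $x:\sigma\vdash x:\sigma$ ($\sigma$ strict); $(\to_I)$ from $\Gamma,x:\alpha\vdash M:\sigma$ infer $\Gamma\vdash\lambda x.M:\alpha\to\sigma$; $(\to_E)$ for $n\geq 0$, from $\Gamma\vdash M:\cap_i^n\tau_i\to\sigma$ and $\Delta_0\vdash N:\tau_0,\dots,\Delta_n\vdash N:\tau_n$ infer $\Gamma,\Delta_0^\top\sqcap\Delta_1\sqcap\dots\sqcap\Delta_n\vdash MN:\sigma$ (here $\cap_i^n\tau_i=\tau_1\cap\dots\cap\tau_n$, $\tau_0,\dots,\tau_n$ strict); $(Cont)$ from $\Gamma,x:\alpha,y:\beta\vdash M:\sigma$ infer $\Gamma,z:\alpha\cap\beta\vdash z<^x_yM:\sigma$; $(Weak)$ from $\Gamma\vdash M:\sigma$ infer $\Gamma,x:\top\vdash x\odot M:\sigma$. $M$ is typeable if $\Gamma\vdash M:\sigma$ for some basis $\Gamma$ and strict type $\sigma$. *)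

(* Defs.v *)
From Stdlib Require Import Relations.
From mathcomp Require Import all_boot.
From mathcomp Require Import finmap.

Set Implicit Arguments.
Unset Strict Implicit.
Unset Printing Implicit Defensive.

Local Open Scope fset_scope.
Local Open Scope fmap_scope.

Definition var : choiceType := nat.

(* Named pre-terms.  [Weak x f] is the weakening of f by x, and
   [Contr x x1 x2 f] is the contraction of x1, x2 (bound in f) into the free
   variable x.  Renaming of bound variables is part of the congruence [eqv]
   below, modulo which reduction is taken. *)
Inductive term : Type :=
| Var of var
| Abs of var & term
| App of term & term
| Weak of var & term
| Contr of var & var & var & term.

Fixpoint Fv (t : term) : {fset var} :=
  match t with
  | Var x => [fset x]
  | Abs x f => Fv f `\ x
  | App f g => Fv f `|` Fv g
  | Weak x f => x |` Fv f
  | Contr x x1 x2 f => x |` (Fv f `\` [fset x1; x2])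
  end.

Fixpoint wf (t : term) : bool :=
  match t with
  | Var _ => true
  | Abs x f => wf f && (x \in Fv f)
  | App f g => [&& wf f, wf g & [disjoint Fv f & Fv g]%fset]
  | Weak x f => wf f && (x \notin Fv f)
  | Contr x x1 x2 f =>
      [&& wf f, x1 != x2, x1 \in Fv f, x2 \in Fv f
        & x \notin Fv f `\` [fset x1; x2]]
  end.

(* Applies s to every name, binders included; this renames the free variables
   without capture as soon as s is injective. *)
Fixpoint ren (s : var -> var) (t : term) : term :=
  match t with
  | Var x => Var (s x)
  | Abs x f => Abs (s x) (ren s f)
  | App f g => App (ren s f) (ren s g)
  | Weak x f => Weak (s x) (ren s f)
  | Contr x x1 x2 f => Contr (s x) (s x1) (s x2) (ren s f)
  end.

Definition swap (x y : var) : term -> term :=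
  ren [fun z : var => z with x |-> y, y |-> x].

Inductive ctx_clos (R : relation term) : relation term :=
| ctx_root M M' : R M M' -> ctx_clos R M M'
| ctx_abs x M M' : ctx_clos R M M' -> ctx_clos R (Abs x M) (Abs x M')
| ctx_appl M M' N : ctx_clos R M M' -> ctx_clos R (App M N) (App M' N)
| ctx_appr M N N' : ctx_clos R N N' -> ctx_clos R (App M N) (App M N')
| ctx_weak x M M' : ctx_clos R M M' -> ctx_clos R (Weak x M) (Weak x M')
| ctx_contr x x1 x2 M M' :
    ctx_clos R M M' -> ctx_clos R (Contr x x1 x2 M) (Contr x x1 x2 M').

(* The first two clauses are renaming of bound variables (the second binder of
   a contraction is reached through [ax_contr_comm]). *)
Inductive eqv_ax : relation term :=
| ax_alpha_abs x y M :
    y \notin Fv M -> eqv_ax (Abs x M) (Abs y (swap x y M))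
| ax_alpha_contr x x1 x2 y M :
    y \notin Fv M -> eqv_ax (Contr x x1 x2 M) (Contr x y x2 (swap x1 y M))
| ax_weak_weak x y M : eqv_ax (Weak x (Weak y M)) (Weak y (Weak x M))
| ax_contr_comm x x1 x2 M : eqv_ax (Contr x x1 x2 M) (Contr x x2 x1 M)
| ax_contr_assoc x y z u v M :
    eqv_ax (Contr x y z (Contr y u v M)) (Contr x y u (Contr y z v M))
| ax_contr_contr x x1 x2 y y1 y2 M :
    x != y1 -> x != y2 -> y != x1 -> y != x2 ->
    eqv_ax (Contr x x1 x2 (Contr y y1 y2 M)) (Contr y y1 y2 (Contr x x1 x2 M)).

(* An axiom instance counts only if both sides are well-formed; this excludes,
   e.g., y = u in [ax_contr_assoc]. *)
Definition eqv : relation term :=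
  clos_refl_sym_trans term
    (ctx_clos (fun M M' => [/\ wf M, wf M' & eqv_ax M M'])).

Definition weaks (X : {fset var}) (M : term) : term :=
  foldr Weak M (enum_fset X).

(* X <^{f(X)}_{g(X)} M *)
Definition contrs (X : {fset var}) (f g : var -> var) (M : term) : term :=
  foldr (fun x P => Contr x (f x) (g x) P) M (enum_fset X).

(* [subst M x N R] means M[N/x] = R.  It is a relation because no clause
   applies when a binder of M would capture a free variable of N; an
   equivalent M (renaming of bound variables) then has to be used.  In the last
   clause N1 = [ren f1 N] and N2 = [ren f2 N]. *)
Inductive subst : term -> var -> term -> term -> Prop :=
| subst_var x N : subst (Var x) x N N
| subst_abs y M x N R :
    x != y -> y \notin Fv N ->
    subst M x N R -> subst (Abs y M) x N (Abs y R)
| subst_appl M P x N R :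
    x \notin Fv P -> subst M x N R -> subst (App M P) x N (App R P)
| subst_appr M P x N R :
    x \notin Fv M -> subst P x N R -> subst (App M P) x N (App M R)
| subst_weak y M x N R :
    x != y -> subst M x N R -> subst (Weak y M) x N (Weak y R)
| subst_weak_eq x M N : subst (Weak x M) x N (weaks (Fv N) M)
| subst_contr y y1 y2 M x N R :
    x != y -> x != y1 -> x != y2 -> y1 \notin Fv N -> y2 \notin Fv N ->
    subst M x N R -> subst (Contr y y1 y2 M) x N (Contr y y1 y2 R)
| subst_contr_eq x x1 x2 M N f1 f2 R1 R :
    injective f1 -> injective f2 ->
    (forall z, z \in Fv N ->
       f1 z \notin [fset x; x1; x2] `|` Fv M `|` Fv N) ->
    (forall z, z \in Fv N ->
       f2 z \notin [fset x; x1; x2] `|` Fv M `|` Fv N) ->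
    (forall z w, z \in Fv N -> w \in Fv N -> f1 z != f2 w) ->
    subst M x1 (ren f1 N) R1 -> subst R1 x2 (ren f2 N) R ->
    subst (Contr x x1 x2 M) x N (contrs (Fv N) f1 f2 R).

(* Side conditions avoiding capture are listed only when they do not already
   follow from well-formedness of the left-hand side. *)
Inductive red_ax : relation term :=
| ax_beta x M N R : subst M x N R -> red_ax (App (Abs x M) N) R
| ax_gamma1 x x1 x2 y M :
    y != x ->
    red_ax (Contr x x1 x2 (Abs y M)) (Abs y (Contr x x1 x2 M))
| ax_gamma2 x x1 x2 M N :
    x1 \notin Fv N -> x2 \notin Fv N ->
    red_ax (Contr x x1 x2 (App M N)) (App (Contr x x1 x2 M) N)
| ax_gamma3 x x1 x2 M N :
    x1 \notin Fv M -> x2 \notin Fv M ->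
    red_ax (Contr x x1 x2 (App M N)) (App M (Contr x x1 x2 N))
| ax_omega1 x y M :
    x != y -> red_ax (Abs x (Weak y M)) (Weak y (Abs x M))
| ax_omega2 x M N : red_ax (App (Weak x M) N) (Weak x (App M N))
| ax_omega3 x M N : red_ax (App M (Weak x N)) (Weak x (App M N))
| ax_gammaomega1 x x1 x2 y M :
    y != x1 -> y != x2 ->
    red_ax (Contr x x1 x2 (Weak y M)) (Weak y (Contr x x1 x2 M))
| ax_gammaomega2 x x1 x2 M R :
    subst M x2 (Var x) R -> red_ax (Contr x x1 x2 (Weak x1 M)) R.

Definition red (M M' : term) : Prop :=
  exists N N', [/\ eqv M N, ctx_clos red_ax N N' & eqv N' M'].

(* The smallest set containing a term whenever it contains all its reducts. *)
Definition SN (M : term) : Prop := Acc (fun P' P => red P P') M.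

(* A type s1 /\ ... /\ sn is the list [:: s1; ...; sn] of its strict
   components: intersection is ++, the neutral element is [::], and a strict
   type s, seen as a type, is [:: s]. *)
Inductive sty : Type :=
| Atom of nat
| Arr of seq sty & sty.

Definition ty : Type := seq sty.

(* Associativity and neutrality hold by computation on lists; commutativity
   and idempotence are imposed here, hereditarily. *)
Inductive sty_eq : sty -> sty -> Prop :=
| sty_eq_refl s : sty_eq s s
| sty_eq_sym s t : sty_eq s t -> sty_eq t s
| sty_eq_trans s t u : sty_eq s t -> sty_eq t u -> sty_eq s u
| sty_eq_arr a b s t : ty_eq a b -> sty_eq s t -> sty_eq (Arr a s) (Arr b t)
with ty_eq : ty -> ty -> Prop :=
| ty_eq_refl a : ty_eq a a
| ty_eq_sym a b : ty_eq a b -> ty_eq b a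
| ty_eq_trans a b c : ty_eq a b -> ty_eq b c -> ty_eq a c
| ty_eq_strict s t : sty_eq s t -> ty_eq [:: s] [:: t]
| ty_eq_cap a a' b b' : ty_eq a a' -> ty_eq b b' -> ty_eq (a ++ b) (a' ++ b')
| ty_eq_comm a b : ty_eq (a ++ b) (b ++ a)
| ty_eq_idem a : ty_eq (a ++ a) a.

Definition basis : Type := {fmap var -> ty}.

Definition lookup (G : basis) (x : var) : ty := odflt [::] G.[? x].

Definition basis_eq (G D : basis) : Prop :=
  domf G = domf D /\ forall x, ty_eq (lookup G x) (lookup D x).

Definition top_basis (G : basis) : basis := [fmap x : domf G => [::] : ty].

(* Only meant for domf G = domf D. *)
Definition cap_basis (G D : basis) : basis :=
  [fmap x : domf G => lookup G (val x) ++ lookup D (val x)].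

Inductive typ : basis -> term -> sty -> Prop :=
| typ_ax x s : typ [fmap].[x <- [:: s]] (Var x) s
| typ_abs (G : basis) x a M s :
    x \notin domf G ->
    typ G.[x <- a] M s -> typ G (Abs x M) (Arr a s)
| typ_app (n : nat) (t : nat -> sty) (G : basis) (D : nat -> basis) M N s :
    typ G M (Arr [seq t i | i <- iota 1 n] s) ->
    (forall i, i <= n -> typ (D i) N (t i)) ->
    (forall i, i <= n -> domf (D i) = domf (D 0)) ->
    [disjoint domf G & domf (D 0)]%fset ->
    typ (G + foldl cap_basis (top_basis (D 0)) [seq D i | i <- iota 1 n])
        (App M N) s
| typ_contr (G : basis) x y z a b M s :
    x \notin domf G -> y \notin domf G -> x != y -> z \notin domf G ->
    typ G.[x <- a].[y <- b] M s -> typ G.[z <- a ++ b] (Contr z x y M) s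
| typ_weak (G : basis) x M s :
    x \notin domf G ->
    typ G M s -> typ G.[x <- [::]] (Weak x M) s
(* Types are identified modulo the laws of the intersection. *)
| typ_eqv (G G' : basis) M s s' :
    basis_eq G G' -> sty_eq s s' -> typ G M s -> typ G' M s'.

Definition typeable (M : term) : Prop :=
  exists (G : basis) (s : sty), typ G M s.

(* Main.v *)
From Stdlib Require Import Relations FunctionalExtensionality.
From HB Require Import structures.
Require Import Defs.
From mathcomp Require Import all_boot.
From mathcomp Require Import finmap.

(** Weakenings and contractions only record how often a variable is used, so
    deleting the former and merging the two names bound by the latter erases a
    resource term to a pure lambda-term.  The proof transports the problem along
    this erasure and back.

    Strong normalisation survives erasure ([SN_erase]).  Every structural rule
    (gamma, omega, gamma-omega) leaves the erasure unchanged, and a beta-step of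
    the erasure of [M] can only be prevented from being a step of [M] by
    weakenings or contractions that stand between an abstraction and its
    argument; in that case [M] has a structural step.  So, whenever the erasure
    of [M] has a beta-reduct, [M] has a reduct with the same erasure or a reduct
    that erases to it ([beta_simulation]), and a well-founded induction on the
    reducts of [M] concludes.

    Strongly normalising lambda-terms are typeable ([sn_typeable]) in a system
    that counts resources just as the target system does ([has_type]): a context
    is the multiset of all typed uses of the variables, without weakening or
    idempotence, and the argument of an application is always typed at least
    once.  As usual, neutral terms are typed directly and weak head redexes by
    subject expansion, which rests on [has_type_subst]: a typing of a
    substitution instance splits into a typing of the term and typings of the
    substituted terms.  An argument that the weak head step erases still needs
    some type, and has one because it is a subterm of a strongly normalising term.

    Finally, a typing of the erasure of [M] is a typing of [M]
    ([typ_of_erasure]).  The multiset of uses decides how the type of a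
    contracted variable is shared between its two names, and gives the empty
    intersection to a weakened one.

    The simulation of beta needs that substitution, a partial relation on named
    terms, has a result after a renaming of bound variables ([freshen],
    [subst_exists]) and that it erases to substitution ([subst_spec]). *)

Set Implicit Arguments.
Unset Strict Implicit.
Unset Printing Implicit Defensive.

Local Open Scope fset_scope.
Local Open Scope fmap_scope.

(** * Equality on strict types *)

(* Contexts are compared as multisets of typed variables, hence the need to
   decide the equality of strict types. *)

Fixpoint sty_encode (s : sty) : GenTree.tree nat :=
  match s with
  | Atom n => GenTree.Leaf n
  | Arr a t => GenTree.Node 0 (sty_encode t :: map sty_encode a)
  end.

Fixpoint sty_decode (u : GenTree.tree nat) : sty :=
  match u with
  | GenTree.Leaf n => Atom n
  | GenTree.Node _ l =>
      if map sty_decode l is t :: a then Arr a t else Atom 0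
  end.

Lemma sty_encodeK : cancel sty_encode sty_decode.
Proof.
rewrite /cancel; fix IH 1 => -[n|a t] //=; rewrite IH; congr Arr.
by elim: a => [|s a IHa] //=; rewrite IH IHa.
Qed.

HB.instance Definition _ := Equality.copy sty (can_type sty_encodeK).

(** * Pure lambda-terms *)

Inductive tm : Type :=
| TVar of nat
| TLam of tm
| TApp of tm & tm.

Definition scons (T : Type) (t : T) (f : nat -> T) (n : nat) : T :=
  if n is m.+1 then f m else t.

Fixpoint trename (r : nat -> nat) (t : tm) : tm :=
  match t with
  | TVar n => TVar (r n)
  | TLam t => TLam (trename (scons 0 (fun n => (r n).+1)) t)
  | TApp t u => TApp (trename r t) (trename r u)
  end.

Definition lift_subst (f : nat -> tm) : nat -> tm :=
  scons (TVar 0) (fun n => trename succn (f n)).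

Fixpoint tsubst (f : nat -> tm) (t : tm) : tm :=
  match t with
  | TVar n => f n
  | TLam t => TLam (tsubst (lift_subst f) t)
  | TApp t u => TApp (tsubst f t) (tsubst f u)
  end.

Lemma trename_comp r r' t :
  trename r (trename r' t) = trename (fun n => r (r' n)) t.
Proof.
elim: t r r' => [n|t IH|t IHt u IHu] r r' //=; last by rewrite IHt IHu.
by rewrite IH; congr (TLam (trename _ _)); apply: functional_extensionality => -[].
Qed.

Lemma tsubst_rename f r t :
  tsubst f (trename r t) = tsubst (fun n => f (r n)) t.
Proof.
elim: t f r => [n|t IH|t IHt u IHu] f r //=; last by rewrite IHt IHu.
by rewrite IH; congr (TLam (tsubst _ _)); apply: functional_extensionality => -[].
Qed.

Lemma trename_subst r f t :
  trename r (tsubst f t) = tsubst (fun n => trename r (f n)) t.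
Proof.
elim: t f r => [n|t IH|t IHt u IHu] f r //=; last by rewrite IHt IHu.
rewrite IH; congr (TLam (tsubst _ _)); apply: functional_extensionality => -[//|n].
by rewrite /= !trename_comp.
Qed.

Lemma tsubst_id t : tsubst TVar t = t.
Proof.
elim: t => [n|t IH|t IHt u IHu] //=; last by rewrite IHt IHu.
rewrite -{2}IH; congr (TLam (tsubst _ _)).
by apply: functional_extensionality => -[].
Qed.

Inductive beta : tm -> tm -> Prop :=
| beta_root t u : beta (TApp (TLam t) u) (tsubst (scons u TVar) t)
| beta_lam t t' : beta t t' -> beta (TLam t) (TLam t')
| beta_appl t t' u : beta t t' -> beta (TApp t u) (TApp t' u)
| beta_appr t u u' : beta u u' -> beta (TApp t u) (TApp t u').

(** * Relevant intersection typing of lambda-terms *)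

(** A typing context: one entry for each typed use of a variable. *)
Definition uses (I : Type) : Type := seq (I * sty).

(** [G] is a multiset union of contexts, one for each entry [x] of [l] and related
    to [x] by [P].  With [l] a list of types, these are the premises for the
    argument of an application; with [l] a context, the typings of the terms
    substituted for its variables. *)
Fixpoint sums (X Y : eqType) (P : seq Y -> X -> Prop) (G : seq Y) (l : seq X) : Prop :=
  if l is x :: l' then
    exists D G', [/\ P D x, sums P G' l' & perm_eq G (D ++ G')]
  else G = [::].

Definition maps (I J : Type) (f : I -> J) (U : uses I) : uses J :=
  [seq (f p.1, p.2) | p <- U].

(** The context of the body of an abstraction of domain [a]. *)
Definition bind (a : ty) (G : uses nat) : uses nat :=
  [seq (0, s) | s <- a] ++ maps succn G.

(** The premise about [G0] and [s0] is the extra one of the application rule: it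
    forces the argument to be typeable even when [a] is empty, and its context is
    dropped.  Comparing contexts up to permutation inside the clauses makes the
    system syntax-directed while the components of a domain [a] may come in any
    order. *)
Fixpoint has_type (t : tm) (G : uses nat) (s : sty) : Prop :=
  match t with
  | TVar n => G = [:: (n, s)]
  | TLam t => exists a s' G',
      [/\ s = Arr a s', has_type t G' s' & perm_eq G' (bind a G)]
  | TApp t u => exists a G1 G2,
      [/\ has_type t G1 (Arr a s), sums (has_type u) G2 a,
          exists G0 s0, has_type u G0 s0 & perm_eq G (G1 ++ G2)]
  end.

Lemma sums_permr (X Y : eqType) (P : seq Y -> X -> Prop) G G' l :
  sums P G l -> perm_eq G G' -> sums P G' l.
Proof.
case: l => [->|x l [D [G0 [H1 H2 H3]]] H] /=.
  by rewrite perm_sym => /perm_nilP.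
by exists D, G0; split=> //; rewrite -(permPl H).
Qed.

Lemma sums_cat (X Y : eqType) (P : seq Y -> X -> Prop) G1 G2 l1 l2 :
  sums P G1 l1 -> sums P G2 l2 -> sums P (G1 ++ G2) (l1 ++ l2).
Proof.
elim: l1 G1 => [|x l1 IH] G1 /=; first by move->.
move=> [D [G [H1 H2 H3]]] H4; exists D, (G ++ G2); split=> //; first exact: IH.
by rewrite catA perm_cat2r.
Qed.

Lemma sums_split (X Y : eqType) (P : seq Y -> X -> Prop) G l1 l2 :
  sums P G (l1 ++ l2) ->
  exists G1 G2, [/\ sums P G1 l1, sums P G2 l2 & perm_eq G (G1 ++ G2)].
Proof.
elim: l1 G => [|x l1 IH] G /=; first by exists [::], G.
move=> [D [G' [H1 /IH [G1 [G2 [H2 H3 H4]]] H5]]].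
exists (D ++ G1), G2; split=> //; first by exists D, G1.
by rewrite (permPl H5) -catA perm_cat2l.
Qed.

Lemma sums_perm (X Y : eqType) (P : seq Y -> X -> Prop) G l l' :
  sums P G l -> perm_eq l l' -> sums P G l'.
Proof.
elim: l' l G => [|x l' IH] l G; first by move=> H /perm_nilP e; rewrite e in H.
move=> H e.
have xl : x \in l by rewrite (perm_mem e) mem_head.
case/splitPr: xl H e => l1 l2 /sums_split [G1 [G2 [H1 [D [G3 [H2 H3 H4]]] H5]]] e.
exists D, (G1 ++ G3); split=> //.
  apply: IH (sums_cat H1 H3) _.
  by move: e; rewrite -cat1s perm_catCA cat1s perm_cons.
by rewrite (permPl H5) perm_sym perm_catCA perm_cat2l perm_sym.
Qed.

Lemma sums_comp (X Y Z : eqType) (P : seq Y -> X -> Prop)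
    (Q : seq Z -> X -> Prop) (R : seq Y -> Z -> Prop) G l :
  (forall D x, P D x -> exists2 U, Q U x & sums R D U) ->
  sums P G l -> exists2 U, sums Q U l & sums R G U.
Proof.
move=> H; elim: l G => [|x l IH] G /=; first by move=> ->; exists [::].
move=> [D [G' [/H [U1 H1 H2] /IH [U2 H3 H4] H5]]].
exists (U1 ++ U2); first by exists U1, U2.
by apply: sums_permr (sums_cat H2 H4) _; rewrite perm_sym.
Qed.

Lemma bind_inj a a' G G' :
  perm_eq (bind a G) (bind a' G') -> perm_eq a a' /\ perm_eq G G'.
Proof.
move=> e; split.
  have K (b : ty) (D : uses nat) :
      pmap (fun p : nat * sty => if p.1 is 0 then Some p.2 else None) (bind b D) = b.
    rewrite /bind pmap_cat; set x := pmap _ _; set y := pmap _ _.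
    have -> : x = b by rewrite /x; elim: b {x} => //= s b ->.
    have -> : y = [::] by rewrite /y; elim: D {y} => //=.
    by rewrite cats0.
  by rewrite -(K a G) -(K a' G'); apply: perm_pmap.
have K (b : ty) (D : uses nat) :
    pmap (fun p : nat * sty => if p.1 is n.+1 then Some (n, p.2) else None) (bind b D) = D.
  rewrite /bind pmap_cat; set x := pmap _ _; set y := pmap _ _.
  have -> : x = [::] by rewrite /x; elim: b {x} => //= s b ->.
  by rewrite /y; elim: D {y} => //= -[n s] D /= ->.
by rewrite -(K a G) -(K a' G'); apply: perm_pmap.
Qed.

Lemma bind_split (U : uses nat) : exists a V, perm_eq U (bind a V).
Proof.
elim: U => [|[[|n] s] U [a [V IH]]]; first by exists [::], [::].
  by exists (s :: a), V; rewrite /= perm_cons.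
exists a, ((n, s) :: V).
apply/permP => p; have /permP /(_ p) := IH.
by rewrite /bind /= !count_cat /= => ->; rewrite addnCA.
Qed.

(** How a decomposition of a context crosses a binder.  [P] and [Q] describe the
    contexts allowed inside and outside the abstraction; the entries of the bound
    variable stand for themselves, so they make up the domain [a] exactly. *)
Lemma sums_bind (P Q : uses nat -> nat * sty -> Prop) a G U :
  (forall D s, P D (0, s) -> D = [:: (0, s)]) ->
  (forall D n s, P D (n.+1, s) -> exists2 D', Q D' (n, s) & perm_eq D (maps succn D')) ->
  sums P (bind a G) U ->
  exists2 V, sums Q G V & perm_eq U (bind a V).
Proof.
move=> P0 PS H; have [a' [V e]] := bind_split U.
have [G1 [G2 [H1 H2 H3]]] := sums_split (sums_perm H e).
have E1 : perm_eq G1 [seq (0, s) | s <- a'].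
  elim: a' G1 H1 {e H3} => [|s a' IH] G1 /=; first by move->.
  move=> [D [G' [/P0 -> /IH H4 H5]]].
  by rewrite (permPl H5) /= perm_cons.
have [D E2 E3] : exists2 D, perm_eq G2 (maps succn D) & sums Q D V.
  elim: V G2 H2 {e H3} => [|[n s] V IH] G2 /=; first by move->; exists [::].
  move=> [D [G' [/PS [D' H4 H5] /IH [D2 H6 H7] H8]]].
  exists (D' ++ D2); last by exists D', D2.
  by rewrite /maps map_cat (permPl H8) perm_cat.
have /bind_inj [e1 e2] : perm_eq (bind a G) (bind a' D).
  by rewrite (permPl H3) perm_cat.
exists V; first by apply: sums_permr E3 _; rewrite perm_sym.
by rewrite (permPl e) perm_cat2r; apply: perm_map; rewrite perm_sym.
Qed.

Lemma sums_var (r : nat -> nat) G U :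
  sums (fun D p => has_type (TVar (r p.1)) D p.2) G U -> perm_eq G (maps r U).
Proof.
elim: U G => [|[n s] U IH] G /=; first by move->.
by move=> [D [G' [-> /IH H4 H5]]]; rewrite (permPl H5) perm_cons.
Qed.

(** The case of renamings comes first because lifting a substitution under a
    binder renames the substituted terms. *)
Lemma has_type_rename t r G s :
  has_type (trename r t) G s ->
  exists2 U, has_type t U s & sums (fun D p => has_type (TVar (r p.1)) D p.2) G U.
Proof.
elim: t r G s => [n|t IH|t IHt u IHu] r G s.
- move=> ->; exists [:: (n, s)] => //=.
  by exists [:: (r n, s)], [::].
- move=> /= [a [s' [G' [-> /IH [U H1 H2] H3]]]].
  have [||V H4 H5] := @sums_bind _ (fun D p => has_type (TVar (r p.1)) D p.2)
    _ _ _ _ _ (sums_permr H2 H3).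
  + by move=> D s'' /=.
  + by move=> D n s'' /= ->; exists [:: (r n, s'')]; first reflexivity.
  by exists V => //; exists a, s', U.
- move=> /= [a [G1 [G2 [/IHt [U1 H1 H2] H3 [G0 [s0 /IHu [U0 H4 _]]] H5]]]].
  have [U2 H6 H7] := sums_comp (fun D x => @IHu r D x) H3.
  exists (U1 ++ U2); first by exists a, U1, U2; split=> //; exists U0, s0.
  by apply: sums_permr (sums_cat H2 H7) _; rewrite perm_sym.
Qed.

(** Each use of a substituted term inside a derivation is replaced by an axiom of
    the same type; relevance then makes the contexts add up. *)
Lemma has_type_subst t f G s :
  has_type (tsubst f t) G s ->
  exists2 U, has_type t U s & sums (fun D p => has_type (f p.1) D p.2) G U.
Proof.
elim: t f G s => [n|t IH|t IHt u IHu] f G s.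
- move=> H; exists [:: (n, s)] => //=.
  by exists G, [::]; rewrite cats0.
- move=> /= [a [s' [G' [-> /IH [U H1 H2] H3]]]].
  have [||V H4 H5] := @sums_bind _ (fun D p => has_type (f p.1) D p.2)
    _ _ _ _ _ (sums_permr H2 H3).
  + by move=> D s'' /=.
  + move=> D n s'' /= /has_type_rename [U' H4 /sums_var H5].
    by exists U'; first exact: H4.
  by exists V => //; exists a, s', U.
- move=> /= [a [G1 [G2 [/IHt [U1 H1 H2] H3 [G0 [s0 /IHu [U0 H4 _]]] H5]]]].
  have [U2 H6 H7] := sums_comp (fun D x => @IHu f D x) H3.
  exists (U1 ++ U2); first by exists a, U1, U2; split=> //; exists U0, s0.
  by apply: sums_permr (sums_cat H2 H7) _; rewrite perm_sym.
Qed.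

Definition tm_typeable (t : tm) : Prop := exists G s, has_type t G s.

(** Subject expansion.  The typeability of [u] is the missing premise when [t] does
    not use its bound variable, so that [u] is absent from the contractum. *)
Lemma beta_expansion t u G s :
  has_type (tsubst (scons u TVar) t) G s -> tm_typeable u ->
  has_type (TApp (TLam t) u) G s.
Proof.
move=> /has_type_subst [U H1 H2] Tu.
have [a [V e]] := bind_split U.
have [G1 [G2 [H3 H4 H5]]] := sums_split (sums_perm H2 e).
exists a, V, G1; split=> //.
- by exists a, s, U.
- elim: {e} a G1 H3 {H5} => //= s' a IH G1 [D [G' [H6 H7 H8]]].
  by exists D, G'; split=> //; apply: IH.
- rewrite (permPl H5) perm_catC perm_cat2r.
  elim: V G2 H4 {e H5} => [|[n s'] V IH] G2 /=; first by move->.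
  by move=> [D [G' [-> /IH H4 H5]]]; rewrite (permPl H5) perm_cons.
Qed.

Fixpoint hereditarily (P : tm -> Prop) (t : tm) : Prop :=
  P t /\ match t with
         | TVar _ => True
         | TLam t => hereditarily P t
         | TApp t u => hereditarily P t /\ hereditarily P u
         end.

Lemma hereditarilyW P t : hereditarily P t -> P t.
Proof. by case: t => [n|t|t u] []. Qed.

Fixpoint neutral (t : tm) : bool :=
  match t with TVar _ => true | TLam _ => false | TApp t _ => neutral t end.

Fixpoint args_typeable (t : tm) : Prop :=
  if t is TApp t u then args_typeable t /\ tm_typeable u else True.

Lemma hereditarily_args t : hereditarily tm_typeable t -> args_typeable t.
Proof.
by elim: t => [n|t _|t IHt u _] //= [_ [/IHt ? /hereditarilyW ?]].
Qed.

(** The head variable can be given whatever type the arguments require. *)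
Lemma neutral_typeable t s :
  neutral t -> args_typeable t -> exists G, has_type t G s.
Proof.
elim: t s => [n|t _|t IHt u _] s //=; first by exists [:: (n, s)].
move=> nt [Ht [D [s' Hu]]].
have [G HG] := IHt (Arr [:: s'] s) nt Ht.
exists (G ++ D), [:: s'], G, D; split=> //; last by exists D, s'.
by exists D, [::]; rewrite cats0.
Qed.

Inductive whead : tm -> tm -> Prop :=
| whead_root t u : whead (TApp (TLam t) u) (tsubst (scons u TVar) t)
| whead_app t t' u : whead t t' -> whead (TApp t u) (TApp t' u).

Lemma whead_beta t t' : whead t t' -> beta t t'.
Proof. by elim=> *; constructor. Qed.

Lemma whead_expansion t t' G s :
  whead t t' -> args_typeable t -> has_type t' G s -> has_type t G s.
Proof.
move=> H; elim: H G s => {t t'} [t u|t t' u _ IH] G s.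
  by move=> [_ Tu] H; apply: beta_expansion.
move=> [Ht _] [a [G1 [G2 [H1 H2 H3 H4]]]].
by exists a, G1, G2; split=> //; apply: IH.
Qed.

Lemma head_cases t :
  [\/ exists u, t = TLam u, neutral t | exists t', whead t t'].
Proof.
elim: t => [n|t _|t IHt u _]; [by constructor 2 | by constructor 1; exists t |].
case: IHt => [[v ->]|nt|[t' H]].
- by constructor 3; eexists; apply: whead_root.
- by constructor 2.
- by constructor 3; eexists; apply: whead_app H.
Qed.

(** Carrying all subterms along provides the types of arguments, in particular of
    those that a weak head step erases. *)
Lemma hereditarily_typeable_step t :
  (forall t', beta t t' -> hereditarily tm_typeable t') -> hereditarily tm_typeable t.
Proof.
elim: t => [n|t IHt|t IHt u IHu] H /=.
- by split=> //; exists [:: (n, Atom 0)], (Atom 0).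
- have Ht : hereditarily tm_typeable t.
    by apply: IHt => t' Hb; case: (H _ (beta_lam Hb)).
  split=> //; have [G [s HG]] := hereditarilyW Ht.
  have [a [V e]] := bind_split G.
  by exists V, (Arr a s), a, s, G.
have Ht : hereditarily tm_typeable t.
  by apply: IHt => t' Hb; case: (H _ (beta_appl u Hb)) => _ [].
have Hu : hereditarily tm_typeable u.
  by apply: IHu => u' Hb; case: (H _ (beta_appr t Hb)) => _ [].
split=> //.
have Hargs : args_typeable (TApp t u).
  by split; [apply: hereditarily_args | apply: hereditarilyW].
case: (head_cases (TApp t u)) => [[]//|nt|[t' Hw]].
- by have [G HG] := neutral_typeable (Atom 0) nt Hargs; exists G, (Atom 0).
- have [G [s Hs]] := hereditarilyW (H _ (whead_beta Hw)).
  by exists G, s; apply: whead_expansion Hw Hargs Hs.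
Qed.

Lemma sn_typeable t : Acc (fun t' t => beta t t') t -> tm_typeable t.
Proof.
move=> H; apply: hereditarilyW; elim: H => {}t _ IH.
exact: hereditarily_typeable_step.
Qed.

(** * Erasure *)

Definition upd (T : Type) (f : var -> T) (x : var) (t : T) (z : var) : T :=
  if z == x then t else f z.

Definition liftv (x : var) (f : var -> tm) : var -> tm :=
  upd (fun z => trename succn (f z)) x (TVar 0).

(** The environment [f] ranges over arbitrary terms, rather than indices, so that
    erasing the result of a substitution is erasing in an updated environment. *)
Fixpoint erase (f : var -> tm) (M : term) : tm :=
  match M with
  | Var x => f x
  | Abs x M => TLam (erase (liftv x f) M)
  | App M N => TApp (erase f M) (erase f N)
  | Weak _ M => erase f M
  | Contr x x1 x2 M => erase (upd (upd f x1 (f x)) x2 (f x)) M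
  end.

Lemma eq_erase f g M : {in Fv M, f =1 g} -> erase f M = erase g M.
Proof.
elim: M f g => [x|x M IH|M IHM N IHN|x M IH|x x1 x2 M IH] f g H /=.
- by apply: H; rewrite inE.
- congr TLam; apply: IH => z zM; rewrite /liftv /upd; case: eqP => // /eqP zx.
  by rewrite H // !inE zx.
- by rewrite (IHM f g) 1?(IHN f g) // => z zM; apply: H; rewrite inE zM ?orbT.
- by apply: IH => z zM; apply: H; rewrite !inE zM orbT.
- apply: IH => z zM; rewrite /upd.
  have Hx : f x = g x by apply: H; rewrite !inE eqxx.
  case: eqP => // /eqP z2; case: eqP => // /eqP z1.
  by apply: H; rewrite !inE zM (negPf z1) (negPf z2) orbT.
Qed.

Lemma trename_erase r f M :
  trename r (erase f M) = erase (fun z => trename r (f z)) M.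
Proof.
elim: M r f => [x|x M IH|M IHM N IHN|x M IH|x x1 x2 M IH] r f //=.
- rewrite IH; congr TLam; apply: eq_erase => z _; rewrite /liftv /upd.
  by case: eqP => //= _; rewrite !trename_comp.
- by rewrite IHM IHN.
- by rewrite IH; apply: eq_erase => z _; rewrite /upd; do 2 case: eqP => //.
Qed.

Lemma tsubst_erase g f M :
  tsubst g (erase f M) = erase (fun z => tsubst g (f z)) M.
Proof.
elim: M g f => [x|x M IH|M IHM N IHN|x M IH|x x1 x2 M IH] g f //=.
- rewrite IH; congr TLam; apply: eq_erase => z _; rewrite /liftv /upd.
  by case: eqP => //= _; rewrite tsubst_rename trename_subst.
- by rewrite IHM IHN.
- by rewrite IH; apply: eq_erase => z _; rewrite /upd; do 2 case: eqP => //.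
Qed.

(** * Renaming and fresh names *)

Lemma mem_Fv_ren s M z : injective s -> (s z \in Fv (ren s M)) = (z \in Fv M).
Proof.
move=> si; elim: M => [x|x M IH|M IHM N IHN|x M IH|x x1 x2 M IH] /=;
  by rewrite !inE ?(inj_eq si) ?IH ?IHM ?IHN.
Qed.

Lemma Fv_renP s M z : z \in Fv (ren s M) -> exists2 w, w \in Fv M & z = s w.
Proof.
elim: M => [x|x M IH|M IHM N IHN|x M IH|x x1 x2 M IH] /=.
- by rewrite inE => /eqP ->; exists x; rewrite ?inE.
- rewrite !inE => /andP [zx /IH [w wM e]]; exists w => //.
  by rewrite !inE wM andbT; apply: contraNneq zx => <-; rewrite e.
- by rewrite inE => /orP [/IHM|/IHN] [w wM e]; exists w; rewrite // inE wM ?orbT.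
- rewrite !inE => /orP [/eqP ->|/IH [w wM e]]; first by exists x; rewrite ?inE ?eqxx.
  by exists w; rewrite // !inE wM orbT.
- rewrite !inE => /orP [/eqP ->|/andP [zx /IH [w wM e]]].
    by exists x; rewrite ?inE ?eqxx.
  exists w; rewrite // !inE wM andbT; apply/orP; right.
  by apply: contra zx => /orP [] /eqP <-; rewrite e eqxx ?orbT.
Qed.

Lemma wf_ren s M : injective s -> wf (ren s M) = wf M.
Proof.
move=> si; elim: M => [x|x M IH|M IHM N IHN|x M IH|x x1 x2 M IH] //=.
- by rewrite IH mem_Fv_ren.
- rewrite IHM IHN; congr [&& _, _ & _]; apply/fdisjointP/fdisjointP => H z zM.
    by rewrite -(mem_Fv_ren _ z si) H // mem_Fv_ren.
  by have [w wM ->] := Fv_renP zM; rewrite mem_Fv_ren // H.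
- by rewrite IH mem_Fv_ren.
- by rewrite IH !inE !mem_Fv_ren // !(inj_eq si).
Qed.

Lemma erase_ren s f M : injective s -> erase f (ren s M) = erase (fun z => f (s z)) M.
Proof.
move=> si; elim: M f => [x|x M IH|M IHM N IHN|x M IH|x x1 x2 M IH] f //=.
- rewrite IH; congr TLam; apply: eq_erase => z _.
  by rewrite /liftv /upd (inj_eq si).
- by rewrite IHM IHN.
- by rewrite IH; apply: eq_erase => z _; rewrite /upd !(inj_eq si).
Qed.

Fixpoint bv (M : term) : {fset var} :=
  match M with
  | Var _ => fset0
  | Abs x M => x |` bv M
  | App M N => bv M `|` bv N
  | Weak _ M => bv M
  | Contr _ x1 x2 M => x1 |` (x2 |` bv M)
  end.

Lemma bv_renP s M z : z \in bv (ren s M) -> exists2 w, w \in bv M & z = s w.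
Proof.
elim: M => [x|x M IH|M IHM N IHN|x M IH|x x1 x2 M IH] //=.
- rewrite !inE => /orP [/eqP ->|/IH [w wM e]]; first by exists x; rewrite ?inE ?eqxx.
  by exists w; rewrite // !inE wM orbT.
- by rewrite inE => /orP [/IHM|/IHN] [w wM e]; exists w; rewrite // inE wM ?orbT.
- rewrite !inE => /or3P [/eqP ->|/eqP ->|/IH [w wM e]].
  + by exists x1; rewrite ?inE ?eqxx.
  + by exists x2; rewrite ?inE ?eqxx ?orbT.
  + by exists w; rewrite // !inE wM !orbT.
Qed.

Definition vswap (x y : var) : var -> var := [fun z : var => z with x |-> y, y |-> x].

Lemma vswapK x y : involutive (vswap x y).
Proof.
move=> z; rewrite /vswap /=; case: (eqVneq z x) => [->|zx].
  by case: (eqVneq y x) => [->|_]; rewrite ?eqxx.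
by case: (eqVneq z y) => [->|zy]; rewrite ?eqxx // (negPf zx) (negPf zy).
Qed.

Definition vswap_inj x y : injective (vswap x y) := inv_inj (vswapK x y).

Lemma vswapL x y : vswap x y x = y.
Proof. by rewrite /vswap /= eqxx. Qed.

Lemma vswapR x y : vswap x y y = x.
Proof. by rewrite -{2}(vswapL x y) vswapK. Qed.

Lemma vswap_eq x y z : (vswap x y z == y) = (z == x).
Proof. by rewrite -[LHS](inj_eq (@vswap_inj x y)) vswapK vswapR. Qed.

Lemma vswapD x y z : z != x -> z != y -> vswap x y z = z.
Proof. by rewrite /vswap /= => /negPf -> /negPf ->. Qed.

Lemma mem_Fv_swap x y M z : (z \in Fv (ren (vswap x y) M)) = (vswap x y z \in Fv M).
Proof. by rewrite -{1}(vswapK x y z) mem_Fv_ren //; apply: vswap_inj. Qed.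

(** Adding a large constant is an injective renaming with fresh values, as needed
    for the two copies of a term in the substitution for a contracted variable. *)
Definition shiftv (K : nat) (z : var) : var := (z + K)%N.

Lemma shiftv_inj K : injective (shiftv K).
Proof. by move=> z w; apply: addIn. Qed.

Lemma shiftv_fresh (A : {fset var}) :
  exists K, forall z, shiftv K z \notin A.
Proof.
exists (\max_(z <- enum_fset A) (z : nat)).+1 => z; apply/negP => zA.
have := @leq_bigmax_seq nat (enum_fset A) xpredT id _ zA isT.
by rewrite leqNgt /shiftv addnS ltnS leq_addl.
Qed.

Lemma fresh_var (A : {fset var}) : exists x, x \notin A.
Proof. by have [K /(_ 0)] := shiftv_fresh A; exists (shiftv K 0). Qed.

(** * Equivalence and renaming of bound variables *)

Lemma eqv_refl M : eqv M M.
Proof. exact: rst_refl. Qed.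

Lemma eqv_trans M N P : eqv M N -> eqv N P -> eqv M P.
Proof. exact: rst_trans. Qed.

Lemma eqv_ax_eqv M N : wf M -> wf N -> eqv_ax M N -> eqv M N.
Proof. by move=> wM wN H; apply: rst_step; apply: ctx_root. Qed.

Lemma eqv_map (F : term -> term) :
  (forall (R : relation term) M N, ctx_clos R M N -> ctx_clos R (F M) (F N)) ->
  forall M N, eqv M N -> eqv (F M) (F N).
Proof.
move=> H M N; elim=> [M' N' HR|M'|M' N' _ IH|M1 M2 M3 _ IH1 _ IH2].
- by apply: rst_step; apply: H.
- exact: rst_refl.
- exact: rst_sym.
- exact: rst_trans IH1 IH2.
Qed.

Lemma red_map (F : term -> term) :
  (forall (R : relation term) M N, ctx_clos R M N -> ctx_clos R (F M) (F N)) ->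
  forall M N, red M N -> red (F M) (F N).
Proof.
move=> H M N [M' [N' [H1 H2 H3]]]; exists (F M'), (F N').
by split; [apply: eqv_map| apply: H | apply: eqv_map].
Qed.

Lemma red_intro M M' N : eqv M M' -> red_ax M' N -> red M N.
Proof.
by move=> H H'; exists M', N; split=> //; [apply: ctx_root | apply: eqv_refl].
Qed.

Lemma wf_contr_sym x x1 x2 M : wf (Contr x x1 x2 M) -> wf (Contr x x2 x1 M).
Proof.
by move=> /= /and5P [-> x12 -> -> xM]; rewrite eq_sym x12 fsetUC.
Qed.

Lemma Fv_contr_sym x x1 x2 M : Fv (Contr x x1 x2 M) = Fv (Contr x x2 x1 M).
Proof. by rewrite /= (fsetUC [fset x1]). Qed.

Lemma eqv_contr_sym x x1 x2 M :
  wf (Contr x x1 x2 M) -> eqv (Contr x x1 x2 M) (Contr x x2 x1 M).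
Proof.
by move=> wC; apply: (eqv_ax_eqv wC (wf_contr_sym wC)); apply: ax_contr_comm.
Qed.

Lemma erase_contr_sym f x x1 x2 M :
  erase f (Contr x x1 x2 M) = erase f (Contr x x2 x1 M).
Proof. by rewrite /=; apply: eq_erase => z _; rewrite /upd; do 2 case: eqP. Qed.

Lemma alpha_abs x y M : wf (Abs x M) -> y \notin Fv M -> x != y ->
  let M' := ren (vswap x y) M in
  [/\ eqv (Abs x M) (Abs y M'), wf (Abs y M'), Fv (Abs y M') = Fv (Abs x M) &
      forall f, erase f (Abs y M') = erase f (Abs x M)].
Proof.
move=> wM yM xy M'; have si := @vswap_inj x y.
have wM' : wf (Abs y M').
  by move: wM; rewrite /= wf_ren // mem_Fv_swap vswapR.
split=> //; first by apply: eqv_ax_eqv => //; apply: ax_alpha_abs.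
- apply/fsetP => z; rewrite /= !inE mem_Fv_swap.
  case: (eqVneq z x) => [->|zx]; first by rewrite vswapL (negPf yM) andbF.
  case: (eqVneq z y) => [->|zy]; first by rewrite (negPf yM).
  by rewrite vswapD.
- move=> f /=; congr TLam; rewrite erase_ren //; apply: eq_erase => z zM.
  rewrite /liftv /upd vswap_eq; case: eqP => // /eqP zx.
  by rewrite vswapD //; apply: contraNneq yM => <-.
Qed.

Lemma alpha_contr x x1 x2 y M :
  wf (Contr x x1 x2 M) -> y \notin Fv M -> y != x1 -> y != x2 -> y != x ->
  let M' := ren (vswap x1 y) M in
  [/\ eqv (Contr x x1 x2 M) (Contr x y x2 M'), wf (Contr x y x2 M'),
      Fv (Contr x y x2 M') = Fv (Contr x x1 x2 M) &
      forall f, erase f (Contr x y x2 M') = erase f (Contr x x1 x2 M)].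
Proof.
move=> wM yM y1 y2 yx M'; have si := @vswap_inj x1 y.
have [wM0 x12 x1M x2M xM] := and5P wM.
have eF : Fv (Contr x y x2 M') = Fv (Contr x x1 x2 M).
  apply/fsetP => z; rewrite /= !inE mem_Fv_swap.
  case: (eqVneq z x1) => [->|z1]; first by rewrite vswapL (negPf yM) andbF.
  case: (eqVneq z y) => [->|zy]; first by rewrite (negPf yM) (negPf yx) andbF.
  by rewrite vswapD.
have wM' : wf (Contr x y x2 M').
  have e2 : vswap x1 y x2 = x2 by rewrite vswapD // eq_sym.
  rewrite [wf _]/= wf_ren // [wf M]wM0 y2 !inE !mem_Fv_swap vswapR e2 x1M x2M /=.
  move: xM; rewrite !inE (eq_sym x y) (negPf yx) /=.
  case: (eqVneq x x2) => //= _; case: (eqVneq x x1) => [->|xx1] /=.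
    by rewrite vswapL.
  by rewrite vswapD // eq_sym.
split=> //; first by apply: eqv_ax_eqv => //; apply: ax_alpha_contr.
move=> f /=; rewrite erase_ren //; apply: eq_erase => z zM.
rewrite /upd vswap_eq.
case: (eqVneq z x1) => [->|z1]; first by rewrite vswapL !if_same.
have zy : z != y by apply: contraNneq yM => <-.
by rewrite vswapD.
Qed.

(** Renaming [x1] and exchanging the two binders: applied twice, this freshens
    both binders of a contraction although renaming only reaches the first. *)
Lemma freshen_contr_binder (A : {fset var}) x x1 x2 M :
  wf (Contr x x1 x2 M) -> [disjoint bv M & A]%fset ->
  exists y M', [/\ eqv (Contr x x1 x2 M) (Contr x x2 y M'), wf (Contr x x2 y M'),
    Fv (Contr x x2 y M') = Fv (Contr x x1 x2 M),
    forall f, erase f (Contr x x2 y M') = erase f (Contr x x1 x2 M) &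
    [disjoint bv M' & A]%fset /\ y \notin A].
Proof.
move=> wC /fdisjointP dM.
have [y] := fresh_var (A `|` (x1 |` (x2 |` (x |` (Fv M `|` bv M))))).
rewrite !inE !negb_or => /andP [yA /and5P [y1 y2 yx yM yb]].
have [E1 E2 E3 E4] := alpha_contr wC yM y1 y2 yx.
move: E1 E2 E3 E4; set M' := ren _ _ => E1 E2 E3 E4.
exists y, M'; split.
- by apply: eqv_trans E1 (eqv_contr_sym E2).
- exact: wf_contr_sym.
- by rewrite Fv_contr_sym.
- by move=> f; rewrite erase_contr_sym.
- split=> //; apply/fdisjointP => z /bv_renP [v vM ->].
  case: (eqVneq v x1) => [->|v1]; first by rewrite vswapL.
  by rewrite vswapD ?dM //; apply: contraNneq yb => <-.
Qed.

(** The variable convention: bound names may be assumed to avoid any given set. *)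
Lemma freshen (A : {fset var}) M : wf M ->
  exists M', [/\ eqv M M', wf M', Fv M' = Fv M, (forall f, erase f M' = erase f M)
               & [disjoint bv M' & A]%fset].
Proof.
elim: M => [x|x M IH|M IHM N IHN|x M IH|x x1 x2 M IH] wM.
- exists (Var x); split=> //; [exact: eqv_refl | exact: fdisjoint0X].
- case/andP: (wM) => wM0 xM.
  have [M1 [H1 H2 H3 H4 /fdisjointP H5]] := IH wM0.
  have w1 : wf (Abs x M1) by rewrite /= H2 H3.
  have [y] := fresh_var (A `|` (Fv M1 `|` (x |` bv M1))).
  rewrite !inE !negb_or => /and4P [yA yM yx yb].
  have xy : x != y by rewrite eq_sym.
  have [E1 E2 E3 E4] := alpha_abs w1 yM xy.
  exists (Abs y (ren (vswap x y) M1)); split=> //.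
  + by apply: eqv_trans E1; apply: (eqv_map (F := Abs x)) => // *; apply: ctx_abs.
  + by rewrite E3 /= H3.
  + by move=> f; rewrite E4 /= H4.
  + apply/fdisjointP => z /=; rewrite !inE => /orP [/eqP -> //|/bv_renP [w wM1 ->]].
    case: (eqVneq w x) => [->|wx]; first by rewrite vswapL.
    by rewrite vswapD ?H5 //; apply: contraNneq yb => <-.
- case/and3P: wM => wM wN d.
  have [M1 [H1 H2 H3 H4 H5]] := IHM wM.
  have [N1 [K1 K2 K3 K4 K5]] := IHN wN.
  exists (App M1 N1); split.
  + apply: eqv_trans (eqv_map (F := fun M => App M N) _ H1) _.
      by move=> *; apply: ctx_appl.
    by apply: (eqv_map (F := App M1)) => // *; apply: ctx_appr.
  + by rewrite /= H2 K2 H3 K3.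
  + by rewrite /= H3 K3.
  + by move=> f; rewrite /= H4 K4.
  + by rewrite /= fdisjointUX H5.
- case/andP: wM => wM xM; have [M1 [H1 H2 H3 H4 H5]] := IH wM.
  exists (Weak x M1); split=> //=; rewrite ?H2 ?H3 //.
  by apply: (eqv_map (F := Weak x)) => // *; apply: ctx_weak.
- case/and5P: (wM) => wM0 h1 h2 h3 h4.
  have [M1 [H1 H2 H3 H4 H5]] := IH wM0.
  have w1 : wf (Contr x x1 x2 M1) by rewrite /= H2 H3 h1 h2 h3.
  have [y1 [M2 [A1 A2 A3 A4 [A5 A6]]]] := freshen_contr_binder w1 H5.
  have [y2 [M3 [B1 B2 B3 B4 [B5 B6]]]] := freshen_contr_binder A2 A5.
  exists (Contr x y1 y2 M3); split=> //.
  + apply: eqv_trans B1; apply: eqv_trans A1.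
    by apply: (eqv_map (F := Contr x x1 x2)) => // *; apply: ctx_contr.
  + by rewrite B3 A3 /= H3.
  + by move=> f; rewrite B4 A4 /= H4.
  + by rewrite /= !fdisjointU1X A6 B6.
Qed.

(** * Substitution *)

Lemma mem_Fv_renE s M z :
  injective s -> (z \in Fv (ren s M)) = (z \in map s (enum_fset (Fv M))).
Proof.
move=> si; apply/idP/mapP => [/Fv_renP [w wM ->]|[w wM ->]]; first by exists w.
by rewrite mem_Fv_ren.
Qed.

Lemma mem_Fv_foldr_Weak l M z :
  (z \in Fv (foldr Weak M l)) = (z \in l) || (z \in Fv M).
Proof. by elim: l => //= a l IH; rewrite !inE IH orbA. Qed.

Lemma Fv_weaks X M : Fv (weaks X M) = X `|` Fv M.
Proof. by apply/fsetP => z; rewrite inE mem_Fv_foldr_Weak. Qed.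

Lemma wf_weaks X M : wf M -> [disjoint X & Fv M]%fset -> wf (weaks X M).
Proof.
move=> wM /fdisjointP d; rewrite /weaks.
have: {in enum_fset X, forall z, z \notin Fv M} by move=> z zX; apply: d.
have := fset_uniq X; elim: (enum_fset X) => //= a l IH /andP [al ul] H.
rewrite IH //=; last by move=> z zl; apply: H; rewrite inE zl orbT.
by rewrite mem_Fv_foldr_Weak negb_or al H // mem_head.
Qed.

Lemma erase_weaks f X M : erase f (weaks X M) = erase f M.
Proof. by rewrite /weaks; elim: (enum_fset X). Qed.

Local Notation contr_list f1 f2 := (foldr (fun x P => Contr x (f1 x) (f2 x) P)).

Definition fresh_copies (f1 f2 : var -> var) (l : seq var) : Prop :=
  [/\ injective f1, injective f2,
      forall z w, z \in l -> w \in l -> f1 z != f2 w,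
      forall z, z \in l -> f1 z \notin l &
      forall z, z \in l -> f2 z \notin l].

Lemma mem_Fv_contr_list f1 f2 l k R z : fresh_copies f1 f2 l -> {subset k <= l} ->
  (z \in Fv (contr_list f1 f2 R k)) =
  (z \in k) || [&& z \in Fv R, z \notin map f1 k & z \notin map f2 k].
Proof.
move=> [f1i f2i f12 f1l f2l]; elim: k => [|a k IH] kl /=; first by rewrite andbT.
have al : a \in l by apply: kl; rewrite mem_head.
have kl' : {subset k <= l} by move=> u uk; apply: kl; rewrite inE uk orbT.
rewrite !inE IH //; case: (eqVneq z a) => //= za.
case zk: (z \in k) => /=.
  rewrite andbT; have zl := kl' _ zk.
  by apply/norP; split; apply/eqP => e; [have := f1l _ al | have := f2l _ al];
    rewrite -e zl.
by case: (z == f1 a); case: (z == f2 a); rewrite /= ?andbF.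
Qed.

Lemma wf_contr_list f1 f2 l k R : fresh_copies f1 f2 l -> uniq k -> {subset k <= l} -> wf R ->
  {in k, forall z, [/\ f1 z \in Fv R, f2 z \in Fv R & z \notin Fv R]} ->
  wf (contr_list f1 f2 R k).
Proof.
move=> fc uk kl wR; have [f1i f2i f12 f1l f2l] := fc.
elim: k uk kl => [|a k IH] //= /andP [ak uk] kl H.
have al : a \in l by apply: kl; rewrite mem_head.
have kl' : {subset k <= l} by move=> u u_k; apply: kl; rewrite inE u_k orbT.
have [H1 H2 H3] := H a (mem_head _ _).
have K g : (g = f1 \/ g = f2) -> g a \in Fv (contr_list f1 f2 R k).
  move=> Hg; rewrite (mem_Fv_contr_list _ _ fc) //; apply/orP; right; apply/and3P; split.
  - by case: Hg => ->.
  - apply/mapP => -[w wk]; case: Hg => -> e.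
      by move: ak; rewrite (f1i _ _ e) wk.
    by have := f12 _ _ (kl' _ wk) al; rewrite e eqxx.
  - apply/mapP => -[w wk]; case: Hg => -> e.
      by have := f12 _ _ al (kl' _ wk); rewrite e eqxx.
    by move: ak; rewrite (f2i _ _ e) wk.
rewrite IH //; last by move=> u u_k; apply: H; rewrite inE u_k orbT.
rewrite f12 // K ?K; [|by right|by left].
by rewrite inE (mem_Fv_contr_list _ _ fc) // (negPf ak) (negPf H3) andbF.
Qed.

(** Since the contractions are nested, the environment that they build is
    characterised by its values and not by a formula. *)
Lemma erase_contr_list f1 f2 l k f : fresh_copies f1 f2 l -> uniq k -> {subset k <= l} ->
  exists g, [/\ {in k, forall z, g (f1 z) = f z}, {in k, forall z, g (f2 z) = f z},
    forall w, w \notin map f1 k -> w \notin map f2 k -> g w = f w &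
    forall R, erase f (contr_list f1 f2 R k) = erase g R].
Proof.
move=> [f1i f2i f12 f1l f2l]; elim: k f => [|a k IH] f /= uk kl; first by exists f.
case/andP: uk => ak uk.
have al : a \in l by apply: kl; rewrite mem_head.
have kl' : {subset k <= l} by move=> u u_k; apply: kl; rewrite inE u_k orbT.
have [g [g1 g2 g3 g4]] := IH (upd (upd f (f1 a) (f a)) (f2 a) (f a)) uk kl'.
have E z : z \in k -> upd (upd f (f1 a) (f a)) (f2 a) (f a) z = f z.
  move=> zk; rewrite /upd; case: eqP => [e|_].
    by have := f2l _ al; rewrite -e kl'.
  by case: eqP => // e; have := f1l _ al; rewrite -e kl'.
exists g; split=> // [z|z|w].
- rewrite inE; case: (eqVneq z a) => [-> _|_ /= zk]; last by rewrite g1 ?E.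
  rewrite g3; first by rewrite /upd eqxx; case: ifP.
    by apply/mapP => -[w wk /f1i e]; move: ak; rewrite e wk.
  by apply/mapP => -[w wk e]; have := f12 _ _ al (kl' _ wk); rewrite e eqxx.
- rewrite inE; case: (eqVneq z a) => [-> _|_ /= zk]; last by rewrite g2 ?E.
  rewrite g3; first by rewrite /upd eqxx.
    by apply/mapP => -[w wk e]; have := f12 _ _ (kl' _ wk) al; rewrite e eqxx.
  by apply/mapP => -[w wk /f2i e]; move: ak; rewrite e wk.
- rewrite !inE !negb_or => /andP [w1 wk1] /andP [w2 wk2].
  by rewrite g3 // /upd (negPf w1) (negPf w2).
Qed.


(** The number of duplications that a substitution for the free variable [x]
    performs: it follows [x] through the contractions. *)
Fixpoint dup_count (x : var) (M : term) : nat :=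
  match M with
  | Var _ => 0
  | Abs _ M => dup_count x M
  | App M N => if x \in Fv M then dup_count x M else dup_count x N
  | Weak y M => if x == y then 0 else dup_count x M
  | Contr y y1 y2 M => if x == y then (dup_count y1 M + dup_count y2 M).+1 else dup_count x M
  end.

Lemma dup_count_weaks x X M : x \notin X -> dup_count x (weaks X M) = dup_count x M.
Proof.
rewrite /weaks -[x \in X]/(x \in enum_fset X).
by elim: (enum_fset X) => //= a l IH; rewrite inE negb_or => /andP [/negPf -> /IH].
Qed.

Lemma dup_count_contrs x X f1 f2 M : x \notin X -> dup_count x (contrs X f1 f2 M) = dup_count x M.
Proof.
rewrite /contrs -[x \in X]/(x \in enum_fset X).
by elim: (enum_fset X) => //= a l IH; rewrite inE negb_or => /andP [/negPf -> /IH].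
Qed.

(** These facts are proved together: in the clause that duplicates [N], the second
    substitution acts on the result of the first, which must already be known to
    be well-formed with the expected free variables. *)
Lemma subst_spec M x N R : subst M x N R -> wf M -> wf N -> x \in Fv M ->
  (forall z, z \in Fv M -> z != x -> z \notin Fv N) ->
  [/\ wf R, forall z, (z \in Fv R) = (z != x) && (z \in Fv M) || (z \in Fv N),
      forall f, erase f R = erase (upd f x (erase f N)) M &
      forall z, z \in Fv M -> z != x -> dup_count z R = dup_count z M].
Proof.
elim=> {M x N R}.
- move=> x N _ wN _ _; split=> // [z|f|z] /=; first by rewrite inE andNb.
    by rewrite /upd eqxx.
  by rewrite inE => /eqP ->; rewrite eqxx.
- move=> y M x N R xy yN _ IH /= /andP [wM yM] wN; rewrite !inE => /andP [_ xM] d.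
  have [z zM zx|wR FR ER DR] := IH wM wN xM.
  + case: (eqVneq z y) => [-> //|zy]; apply: d => //.
    by rewrite !inE zy.
  split.
  + by rewrite wR FR eq_sym xy yM.
  + move=> z; rewrite !inE FR; case: (eqVneq z y) => [->|] //=.
    by rewrite (negPf yN) andbF.
  + move=> f; rewrite ER; congr TLam; apply: eq_erase => z zM; rewrite /liftv /upd.
    case: (eqVneq z x) => [->|zx //].
    rewrite (negPf xy) trename_erase; apply: eq_erase => w wN'.
    by case: eqP wN' => // ->; rewrite (negPf yN).
  + by move=> z; rewrite !inE => /andP [_ zM] zx; apply: DR.
- move=> M P x N R xP _ IH /= /and3P [wM wP /fdisjointP dMP] wN.
  rewrite inE (negPf xP) orbF => xM d.
  have [z zM zx|wR FR ER DR] := IH wM wN xM.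
  + by apply: d; rewrite // inE zM.
  split.
  + rewrite wR wP; apply/fdisjointP => z; rewrite FR => /orP [/andP [_ /dMP //]|zN].
    apply: contraL zN => zP; apply: d; first by rewrite inE zP orbT.
    by apply: contraNneq xP => <-.
  + move=> z; rewrite !inE FR; case: (eqVneq z x) => [->|] /=; last by rewrite orbAC.
    by rewrite (negPf xP) orbF.
  + move=> f; rewrite ER; congr TApp; apply: eq_erase => z zP.
    by rewrite /upd; case: eqP zP => // ->; rewrite (negPf xP).
  + move=> z zMP zx; rewrite FR zx (negPf (d _ zMP zx)) orbF /=.
    by case zM: (z \in Fv M) => //; apply: DR.
- move=> M P x N R xM _ IH /= /and3P [wM wP /fdisjointP dMP] wN.
  rewrite inE (negPf xM) /= => xP d.
  have [z zM zx|wR FR ER DR] := IH wP wN xP.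
  + by apply: d; rewrite // inE zM orbT.
  split.
  + rewrite wR wM; apply/fdisjointP => z zM; rewrite FR negb_or (negPf (dMP _ zM)) andbF /=.
    apply: d; first by rewrite inE zM.
    by apply: contraNneq xM => <-.
  + move=> z; rewrite !inE FR; case: (eqVneq z x) => [->|] /=; last by rewrite orbA.
    by rewrite (negPf xM).
  + move=> f; rewrite ER; congr TApp; apply: eq_erase => z zM.
    by rewrite /upd; case: eqP zM => // ->; rewrite (negPf xM).
  + move=> z; rewrite inE; case zM: (z \in Fv M) => //= zP zx.
    by apply: DR.
- move=> y M x N R xy _ IH /= /andP [wM yM] wN; rewrite !inE (negPf xy) /= => xM d.
  have [z zM zx|wR FR ER DR] := IH wM wN xM.
  + by apply: d; rewrite // !inE zM orbT.
  split=> //.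
  + rewrite wR FR negb_or (negPf yM) andbF /=; apply: d; first by rewrite !inE eqxx.
    by rewrite eq_sym.
  + move=> z; rewrite !inE FR; case: (eqVneq z x) => [->|] /=; last by rewrite orbA.
    by rewrite (negPf xy).
  + by move=> z; rewrite !inE; case: (z == y) => //= zM; apply: DR.
- move=> x M N /= /andP [wM xM] wN _ d; split.
  + apply: wf_weaks => //; apply/fdisjointP => z zN; apply: contraL zN => zM.
    by apply: d; [rewrite !inE zM orbT | apply: contraNneq xM => <-].
  + move=> z; rewrite Fv_weaks !inE orbC; congr (_ || _).
    by case: (eqVneq z x) => [->|]; rewrite ?(negPf xM).
  + move=> f; rewrite erase_weaks.
    by apply: eq_erase => z zM; rewrite /upd; case: eqP zM => // ->; rewrite (negPf xM).
  + by move=> z zM zx; rewrite dup_count_weaks ?(negPf zx) //; apply: d.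
- move=> y y1 y2 M x N R xy xy1 xy2 y1N y2N _ IH /= /and5P [wM y12 y1M y2M yM] wN.
  rewrite !inE (negPf xy) /= => /andP [_ xM] d.
  have [z zM zx|wR FR ER DR] := IH wM wN xM.
  + case: (eqVneq z y1) => [-> //|z1]; case: (eqVneq z y2) => [-> //|z2].
    by apply: d; rewrite // !inE zM (negPf z1) (negPf z2) orbT.
  have yN : y \notin Fv N by apply: d; rewrite 1?eq_sym // !inE eqxx.
  split.
  + rewrite wR y12 ?inE !FR (eq_sym y1) xy1 y1M (eq_sym y2) xy2 y2M /=.
    by move: yM; rewrite !inE (negPf yN) orbF (eq_sym y x) xy.
  + move=> z; rewrite !inE FR.
    case: (eqVneq z y) => [->|zy] /=; first by rewrite eq_sym xy.
    case: (eqVneq z y1) => [->|zy1] /=; first by rewrite (negPf y1N) andbF.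
    by case: (eqVneq z y2) => [->|zy2] /=; rewrite ?(negPf y2N) ?andbF.
  + move=> f; rewrite ER; apply: eq_erase => z zM; rewrite /upd (eq_sym y x) (negPf xy).
    case: (eqVneq z x) => [->|//]; rewrite (negPf xy1) (negPf xy2).
    apply: eq_erase => w wN'.
    case: eqP wN' => [->|_]; first by rewrite (negPf y2N).
    by case: eqP => // ->; rewrite (negPf y1N).
  + move=> z; rewrite !inE; case: (eqVneq z y) => [_ _ _|_ /= /andP [_ zM]]; last exact: DR.
    by rewrite !DR // eq_sym.
move=> x x1 x2 M N f1 f2 R1 R f1i f2i H1 H2 H12 _ IH1 _ IH2.
move=> /= /and5P [wM x12 x1M x2M xM] wN _ d.
have h1 z : z \in Fv N -> [/\ f1 z != x1, f1 z != x2, f1 z \notin Fv M & f1 z \notin Fv N].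
  by move/H1; rewrite !inE !negb_or -!andbA => /and5P [_ -> -> -> ->].
have h2 z : z \in Fv N -> [/\ f2 z != x1, f2 z != x2, f2 z \notin Fv M & f2 z \notin Fv N].
  by move/H2; rewrite !inE !negb_or -!andbA => /and5P [_ -> -> -> ->].
have [|z zM zx1|wR1 F1 E1 D1] := IH1 wM _ x1M.
- by rewrite wf_ren.
- by apply/negP => /Fv_renP [w /h1 [_ _ e _] e']; rewrite -e' zM in e.
have x2R1 : x2 \in Fv R1 by rewrite F1 // x2M eq_sym x12.
have [|z|wR FR E2 D2] := IH2 wR1 _ x2R1.
- by rewrite wf_ren.
- rewrite F1 => /orP [/andP [_ zM]|/Fv_renP [w wN' ->]] zx2; apply/negP => /Fv_renP [v vN e].
    by have [_ _] := h2 _ vN; rewrite -e zM.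
  by have := H12 _ _ wN' vN; rewrite e eqxx.
have fc : fresh_copies f1 f2 (enum_fset (Fv N)).
  by split=> // z; [move=> /h1 [] | move=> /h2 []].
have E z : (z \in Fv R) = [|| [&& z != x2, z != x1 & z \in Fv M],
    z \in map f1 (enum_fset (Fv N)) | z \in map f2 (enum_fset (Fv N))].
  rewrite FR F1 !mem_Fv_renE //.
  case: (eqVneq z x2) => //= [->|_]; last by rewrite orbA.
  by case: (@mapP _ _ f1) => // -[w /h1 [_ e _ _] e']; rewrite -e' eqxx in e.
have xMN z : z \in Fv N -> [&& z != x2, z != x1 & z \in Fv M] = false.
  move=> zN; apply/negP => /and3P [z2 z1 zM].
  have := d z; rewrite !inE zM (negPf z1) (negPf z2) orbT zN.
  move=> /(_ isT); case: (eqVneq z x) => [e _|_ /(_ isT) //].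
  by move: xM; rewrite !inE -e (negPf z1) (negPf z2) zM.
split.
- apply: (wf_contr_list fc) => // z zN.
  rewrite !E !map_f ?orbT // xMN //=; split=> //; rewrite negb_or.
  by apply/andP; split; apply/mapP => -[w wN' e];
    [have [_ _ _] := h1 _ wN' | have [_ _ _] := h2 _ wN']; rewrite -e zN.
- move=> z; rewrite (mem_Fv_contr_list _ _ fc) // E.
  rewrite -[z \in enum_fset (Fv N)]/(z \in Fv N).
  case zN: (z \in Fv N) => /=; first by rewrite orbT.
  rewrite orbF !inE.
  case: mapP => [[w /h1 [e1 e2 e3 e4] e]|_] /=.
    rewrite andbF -e in e1 e2 e3 *; rewrite (negPf e3) !andbF orbF.
    by case: (z == x).
  case: mapP => [[w /h2 [e1 e2 e3 e4] e]|_] /=.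
    rewrite !andbF -e in e1 e2 e3 *; rewrite (negPf e3) !andbF orbF.
    by case: (z == x).
  rewrite orbF andbT; case: (eqVneq z x) => [->|] /=.
    by apply/negP => /and3P [a b c]; move: xM; rewrite !inE (negPf a) (negPf b) c.
  by move=> _; rewrite negb_or -andbA; case: (z == x2); rewrite ?andbF.
- move=> f.

have [g [g1 g2 g3 Eg]] := erase_contr_list f fc (fset_uniq _) (fun _ => id).
rewrite [LHS]Eg E2 E1 !erase_ren //; apply: eq_erase => z zM; rewrite /upd.
case: (eqVneq z x1) => [->|z1].
  rewrite (negPf x12) eqxx; apply: eq_erase => w wN'; rewrite -g1 //.
  by case: eqP => // e; have [_ + _ _] := h1 _ wN'; rewrite e eqxx.
case: (eqVneq z x2) => [_|z2].
  by rewrite eqxx; apply: eq_erase => w wN'; rewrite -g2.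
case: (eqVneq z x) => [e|zx].
  by move: xM; rewrite !inE -e (negPf z1) (negPf z2) zM.
by apply: g3; apply/mapP => -[w wN' e];
  [have [_ _ + _] := h1 _ wN' | have [_ _ + _] := h2 _ wN']; rewrite -e zM.
- move=> z zxM zx; rewrite (negPf zx) dup_count_contrs; last exact: d.
  move: zxM; rewrite !inE (negPf zx) negb_or /= => /andP [/andP [z1 z2] zM].
  by rewrite D2 ?D1 // F1 z1 zM.
Qed.

(** The clause that duplicates [N] substitutes again in the result of a first
    substitution, which is no subterm of [M]; but that result leaves unchanged the
    number of duplications due to the second name, whence an induction on
    [dup_count] and then on [M].  Only the initial [N] has to avoid the bound names
    of [M], since the copies get fresh names. *)
Lemma subst_exists M x N : wf M -> wf N -> x \in Fv M ->
  (forall z, z \in Fv M -> z != x -> z \notin Fv N) ->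
  [disjoint bv M & Fv N]%fset -> exists R, subst M x N R.
Proof.
move En: (dup_count x M) => n; elim/ltn_ind: n M x N En => n IHn.
elim=> [y|y M IH|M IHM P IHP|y M IH|y y1 y2 M IH] x N /= En.
- by rewrite inE => _ _ /eqP -> _ _; exists N; apply: subst_var.
- move=> /andP [wM yM] wN; rewrite !inE => /andP [xy xM] d.
  rewrite fdisjointU1X => /andP [yN dN].
  have [z zM zx|R HR] := IH x N En wM wN xM _ dN.
    by case: (eqVneq z y) => [-> //|zy]; apply: d; rewrite // !inE zy.
  by exists (Abs y R); apply: subst_abs.
- move=> /and3P [wM wP /fdisjointP dMP] wN xMP d.
  rewrite fdisjointUX => /andP [dM dP]; case xM: (x \in Fv M) in En *.
    have [z zM|R HR] := IHM x N En wM wN xM _ dM; first by apply: d; rewrite inE zM.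
    by exists (App R P); apply: subst_appl => //; apply: dMP.
  have xP : x \in Fv P by move: xMP; rewrite inE xM.
  have [z zP|R HR] := IHP x N En wP wN xP _ dP; first by apply: d; rewrite inE zP orbT.
  by exists (App M R); apply: subst_appr => //; rewrite xM.
- move=> /andP [wM yM] wN xyM d dN; case: (eqVneq x y) => [<-|xy] in En *.
    by exists (weaks (Fv N) M); apply: subst_weak_eq.
  have xM : x \in Fv M by move: xyM; rewrite !inE (negPf xy).
  have [z zM|R HR] := IH x N En wM wN xM _ dN; first by apply: d; rewrite !inE zM orbT.
  by exists (Weak y R); apply: subst_weak.
move=> /and5P [wM y12 y1M y2M yM] wN xyM d.
rewrite !fdisjointU1X => /and3P [y1N y2N dN].
case: (eqVneq x y) => [exy|xy] in En *.
  have [K1 HK1] := shiftv_fresh ([fset x; y1; y2] `|` Fv M `|` Fv N `|` bv M).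
  have i1 := @shiftv_inj K1.
  have d1 z : z \in Fv M -> z != y1 -> z \notin Fv (ren (shiftv K1) N).
    move=> zM _; apply/negP => /Fv_renP [w _ e].
    by have := HK1 w; rewrite !inE -e zM !orbT.
  have [|||R1 HR1] := IHn (dup_count y1 M) _ M y1 (ren (shiftv K1) N) erefl wM _ y1M d1.
  - by rewrite -En ltnS leq_addr.
  - by rewrite wf_ren.
  - apply/fdisjointP => z zM; apply/negP => /Fv_renP [w _ e].
    by have := HK1 w; rewrite !inE -e zM !orbT.
  have wN1 : wf (ren (shiftv K1) N) by rewrite wf_ren.
  have [wR1 F1 _ D1] := subst_spec HR1 wM wN1 y1M d1.
  (* The second copy must also avoid the names brought in by the first. *)
  have [K2 HK2] := shiftv_fresh ([fset x; y1; y2] `|` Fv M `|` Fv N `|` Fv R1 `|` bv R1).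
  have i2 := @shiftv_inj K2.
  have y2R1 : y2 \in Fv R1 by rewrite F1 y2M eq_sym y12.
  have [|||||R HR] := IHn (dup_count y2 M) _ R1 y2 (ren (shiftv K2) N) _ wR1 _ y2R1.
  - by rewrite -En ltnS leq_addl.
  - by rewrite D1 // eq_sym.
  - by rewrite wf_ren.
  - move=> z zM _; apply/negP => /Fv_renP [w _ e].
    by have := HK2 w; rewrite !inE -e zM !orbT.
  - apply/fdisjointP => z zM; apply/negP => /Fv_renP [w _ e].
    by have := HK2 w; rewrite !inE -e zM !orbT.
  exists (contrs (Fv N) (shiftv K1) (shiftv K2) R).
  rewrite -exy; apply: subst_contr_eq HR1 HR => //.
  - by move=> z _; have := HK1 z; rewrite !inE !negb_or => /andP [->].
  - by move=> z _; have := HK2 z; rewrite !inE !negb_or => /andP [/andP [->]].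
  - move=> z w zN wN'; apply: contraNneq (HK2 w) => <-.
    by rewrite !inE F1 mem_Fv_ren // zN !orbT.
have /and3P [x1 x2 xM] : [&& x != y1, x != y2 & x \in Fv M].
  by move: xyM; rewrite !inE (negPf xy) negb_or -andbA.
have [z zM zx|R HR] := IH x N En wM wN xM _ dN.
  case: (eqVneq z y1) => [-> //|z1]; case: (eqVneq z y2) => [-> //|z2].
  by apply: d; rewrite // !inE zM (negPf z1) (negPf z2) orbT.
by exists (Contr y y1 y2 R); apply: subst_contr.
Qed.

(** * Simulation of beta-reduction *)

Definition is_tvar (t : tm) : bool := if t is TVar _ then true else false.

Lemma is_tvar_liftv x f z : (forall z, is_tvar (f z)) -> is_tvar (liftv x f z).
Proof. by move=> H; rewrite /liftv /upd; case: eqP => //; have := H z; case: (f z). Qed.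

Lemma is_tvar_upd x t f z : (forall z, is_tvar (f z)) -> is_tvar t -> is_tvar (upd f x t z).
Proof. by rewrite /upd; case: eqP. Qed.

(** Preservation of well-formedness and free variables is bundled with reduction
    because it is what makes contexts around the redex well-formed again. *)
Definition step (M M' : term) : Prop := [/\ red M M', wf M' & Fv M' = Fv M].

Lemma step_abs x M M' : wf (Abs x M) -> step M M' -> step (Abs x M) (Abs x M').
Proof.
move=> /= /andP [wM xM] [r w e]; split; rewrite /= ?w ?e //.
by apply: (red_map (F := Abs x)) => // *; apply: ctx_abs.
Qed.

Lemma step_appl M M' N : wf (App M N) -> step M M' -> step (App M N) (App M' N).
Proof.
move=> /= /and3P [wM wN d] [r w e]; split; rewrite /= ?w ?e ?wN //.
by apply: (red_map (F := fun M => App M N)) => // *; apply: ctx_appl.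
Qed.

Lemma step_appr M N N' : wf (App M N) -> step N N' -> step (App M N) (App M N').
Proof.
move=> /= /and3P [wM wN d] [r w e]; split; rewrite /= ?w ?e ?wM //.
by apply: (red_map (F := App M)) => // *; apply: ctx_appr.
Qed.

Lemma step_weak x M M' : wf (Weak x M) -> step M M' -> step (Weak x M) (Weak x M').
Proof.
move=> /= /andP [wM xM] [r w e]; split; rewrite /= ?w ?e //.
by apply: (red_map (F := Weak x)) => // *; apply: ctx_weak.
Qed.

Lemma step_contr x x1 x2 M M' :
  wf (Contr x x1 x2 M) -> step M M' -> step (Contr x x1 x2 M) (Contr x x1 x2 M').
Proof.
move=> /= /and5P [wM h1 h2 h3 h4] [r w e].
split; rewrite /= ?w ?e ?h1 ?h2 ?h3 //.
by apply: (red_map (F := Contr x x1 x2)) => // *; apply: ctx_contr.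
Qed.

Lemma step_beta x M N : wf (App (Abs x M) N) ->
  exists2 R, step (App (Abs x M) N) R &
    forall f, erase f R = tsubst (scons (erase f N) TVar) (erase (liftv x f) M).
Proof.
move=> /= /and3P [/andP [wM xM] wN /fdisjointP d].
have [M' [e1 e2 e3 e4 e5]] := freshen (Fv N) wM.
have d' z : z \in Fv M' -> z != x -> z \notin Fv N.
  by rewrite e3 => zM zx; apply: d; rewrite !inE zx.
rewrite -e3 in xM.
have [R HR] := subst_exists e2 wN xM d' e5.
have [wR FR ER _] := subst_spec HR e2 wN xM d'.
exists R.
  split=> //.
    apply: red_intro (ax_beta HR).
    apply: (eqv_map (F := fun P => App P N)); first by move=> *; apply: ctx_appl.
    by apply: (eqv_map (F := Abs x)) => // *; apply: ctx_abs.
  by apply/fsetP => z; rewrite /= !inE FR e3.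
move=> f; rewrite ER tsubst_erase -e4; apply: eq_erase => z _.
rewrite /liftv /upd; case: eqP => // _.
by rewrite tsubst_rename tsubst_id.
Qed.

Lemma step_omega2 y M N : wf (App (Weak y M) N) ->
  step (App (Weak y M) N) (Weak y (App M N)).
Proof.
move=> /= /and3P [/andP [wM yM] wN]; rewrite fdisjointU1X => /andP [yN d].
split; first by apply: red_intro (eqv_refl _) (ax_omega2 _ _ _).
- by rewrite /= wM wN d inE negb_or yM.
- by rewrite /= fsetUA.
Qed.

Lemma step_gamma1 x x1 x2 y M : wf (Contr x x1 x2 (Abs y M)) ->
  exists2 R, step (Contr x x1 x2 (Abs y M)) R &
    forall f, erase f R = erase f (Contr x x1 x2 (Abs y M)).
Proof.
move=> wC.
have [K HK] := shiftv_fresh (x |` (y |` Fv M)).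
move: (HK y); set u := shiftv K y; rewrite !inE !negb_or => /and3P [ux uy uM].
have [wA x12 x1M x2M xM] := and5P wC.
have yu : y != u by rewrite eq_sym.
have [E1 E2 E3 E4] := alpha_abs wA uM yu.
move: E1 E2 E3 E4; set P := ren _ _ => E1 E2 E3 E4.
move: x1M x2M xM; rewrite -E3 [Fv _]/= !inE => /andP [x1u x1P] /andP [x2u x2P].
rewrite (eq_sym x u) (negPf ux) /= => xP.
have [wP uP] : wf P /\ u \in Fv P by move: E2 => /= /andP.
exists (Abs u (Contr x x1 x2 P)).
  split.
  - apply: red_intro (ax_gamma1 _ _ _ ux).
    by apply: (eqv_map (F := Contr x x1 x2)) E1 => // *; apply: ctx_contr.
  - rewrite /= wP x12 x1P x2P !inE xP uP andbT /=; apply/orP; right.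
    by rewrite andbT negb_or !(eq_sym u) x1u.
  - apply/fsetP => z; have /fsetP /(_ z) := E3; rewrite /= !inE => <-.
    case: (eqVneq z u) => [->|zu] //=.
    by rewrite (negPf ux) andbF.
move=> f; have /= <- := E4 (upd (upd f x1 (f x)) x2 (f x)).
congr TLam; apply: eq_erase => z _; rewrite /liftv /upd.
rewrite (eq_sym x u) (negPf ux).
case: (eqVneq z x2) => [->|_]; first by rewrite (negPf x2u).
by case: (eqVneq z x1) => [->|_]; first by rewrite (negPf x1u).
Qed.

Lemma step_gammaomega2 x x1 x2 M : wf (Contr x x1 x2 (Weak x1 M)) ->
  exists2 R, step (Contr x x1 x2 (Weak x1 M)) R &
    forall f, erase f R = erase f (Contr x x1 x2 (Weak x1 M)).
Proof.
move=> wC; have /= /and5P [/andP [wM x1M] x12 _ x2M xM] := wC.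
have [M' [e1 e2 e3 e4 e5]] := freshen [fset x] wM.
rewrite -e3 in x1M.
have {}x2M : x2 \in Fv M' by rewrite e3; move: x2M; rewrite !inE eq_sym (negPf x12).
have {}xM : x != x2 -> x \notin Fv M'.
  move: xM; rewrite !inE; case: (eqVneq x x2) => //= _.
  by case: (eqVneq x x1) => [->|] //=; rewrite e3.
have d z : z \in Fv M' -> z != x2 -> z \notin Fv (Var x).
  move=> zM z2; rewrite inE; apply/negP => /eqP e; move: (xM); rewrite -e => /(_ z2).
  by rewrite zM.
have [R HR] := subst_exists e2 (isT : wf (Var x)) x2M d e5.
have [wR FR ER _] := subst_spec HR e2 (isT : wf (Var x)) x2M d.
exists R.
  split=> //.
    apply: red_intro (ax_gammaomega2 _ HR).
    apply: (eqv_map (F := Contr x x1 x2)); first by move=> *; apply: ctx_contr.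
    by apply: (eqv_map (F := Weak x1)) => // *; apply: ctx_weak.
  apply/fsetP => z; rewrite FR /= -e3 !inE.
  case: (eqVneq z x2) => [->|z2]; first by rewrite /= orbT orbF.
  case: (eqVneq z x1) => [->|z1]; first by rewrite /= (negPf x1M) orbF.
  by rewrite /= orbC.
move=> f; rewrite ER /= -e4; apply: eq_erase => z zM; rewrite /upd /=.
case: (eqVneq z x2) => // _; case: (eqVneq z x1) => // e.
by move: x1M; rewrite -e zM.
Qed.

Lemma step_gammaomega1 x x1 x2 y M : wf (Contr x x1 x2 (Weak y M)) ->
  y != x1 -> y != x2 ->
  step (Contr x x1 x2 (Weak y M)) (Weak y (Contr x x1 x2 M)).
Proof.
move=> wC y1 y2; have /= /and5P [/andP [wM yM] x12 x1M x2M xM] := wC.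
have yx : y != x.
  by apply: contraNneq xM => <-; rewrite !inE eqxx (negPf y1) (negPf y2).
move: x1M x2M xM; rewrite !inE !(eq_sym _ y) (negPf y1) (negPf y2) (negPf yx) /=.
move=> x1M x2M xM.
split; first by apply: red_intro (eqv_refl _) (ax_gammaomega1 _ _ y1 y2).
- by rewrite /= wM x12 x1M x2M !inE (negPf yM) andbF (negPf yx) xM.
- apply/fsetP => z; rewrite /= !inE; case: (eqVneq z y) => [->|_] //=.
  by rewrite (negPf y1) (negPf y2) !orbT.
Qed.

Lemma step_contr_sym x x1 x2 M R :
  wf (Contr x x1 x2 M) -> step (Contr x x2 x1 M) R -> step (Contr x x1 x2 M) R.
Proof.
move=> wC [[P [Q [h1 h2 h3]]] wR FR]; split; rewrite // ?FR 1?Fv_contr_sym //.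
by exists P, Q; split=> //; apply: eqv_trans (eqv_contr_sym wC) h1.
Qed.

(** If [M] erases to an abstraction without being one, then it is an abstraction
    below weakenings and contractions; an outermost weakening can leave the
    function position of an application by omega2, and below an outermost
    contraction stands an abstraction, a weakening or a smaller such term, so that
    one of the gamma and gamma-omega rules applies. *)
Lemma erase_lam_cases M f t : wf M -> (forall z, is_tvar (f z)) -> erase f M = TLam t ->
  [\/ exists x P, M = Abs x P, exists y P, M = Weak y P |
      exists2 M', step M M' & forall g, erase g M' = erase g M].
Proof.
elim: M f t => [x|x M _|M _ N _|x M _|x x1 x2 M IH] f t wM vf //=.
- by have := vf x; case: (f x).
- by constructor 1; exists x, M.
- by constructor 2; exists x, M.
move=> /IH; case=> [|z|[y [P e]]|[y [P e]]|[M' H1 H2]].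
- by case/and5P: wM.
- by apply: is_tvar_upd => // w; apply: is_tvar_upd.
- by subst M; constructor 3; apply: step_gamma1.
- subst M; constructor 3.
  case: (eqVneq y x1) => [e|y1]; first by subst y; apply: step_gammaomega2.
  case: (eqVneq y x2) => [e|y2].
    subst y; have [R H1 H2] := step_gammaomega2 (wf_contr_sym wM).
    exists R; first exact: step_contr_sym.
    by move=> g; rewrite H2 erase_contr_sym.
  by exists (Weak y (Contr x x1 x2 P)) => //; apply: step_gammaomega1.
- constructor 3; exists (Contr x x1 x2 M'); first exact: step_contr.
  by move=> g /=; rewrite H2.
Qed.

(** One step is enough: if the redex of the erasure is hidden by a weakening or a
    contraction, [M] moves it without changing the erasure. *)
Lemma beta_simulation M f t : wf M -> (forall z, is_tvar (f z)) -> beta (erase f M) t ->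
  exists2 M', step M M' & erase f M' = erase f M \/ erase f M' = t.
Proof.
elim: M f t => [x|x M IH|M IHM N IHN|x M IH|x x1 x2 M IH] f t wM vf /= b.
- by have := vf x; case: (f x) b => // n b; inversion b.
- inversion b as [|u u' b' e| |]; subst.
  have [||M' H1 H2] := IH _ _ _ _ b'.
  + by case/andP: wM.
  + by move=> z; apply: is_tvar_liftv.
  exists (Abs x M'); first exact: step_abs.
  by case: H2 => /= ->; [left|right].
- have [wM0 wN d] := and3P wM.
  inversion b as [u v e|u u' b'|u u' v b'|u v v' b']; subst.
  + have [[x [P e1]]|[y [P e1]]|[M' H1 H2]] := erase_lam_cases wM0 vf (esym e).
    * subst M; have [R H1 H2] := step_beta wM; exists R => //; right.
      by rewrite H2; move: e => /= [->].
    * subst M; exists (Weak y (App P N)); first exact: step_omega2.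
      by left; rewrite /= e.
    * exists (App M' N); first exact: step_appl.
      by left; rewrite /= H2 -e.
  + have [M' H1 H2] := IHM _ _ wM0 vf b'.
    exists (App M' N); first exact: step_appl.
    by case: H2 => /= ->; [left|right].
  + have [N' H1 H2] := IHN _ _ wN vf b'.
    exists (App M N'); first exact: step_appr.
    by case: H2 => /= ->; [left|right].
- have [|M' H1 H2] := IH _ _ _ vf b; first by case/andP: wM.
  by exists (Weak x M'); first exact: step_weak.
- have [||M' H1 H2] := IH _ _ _ _ b.
  + by case/and5P: wM.
  + by move=> z; apply: is_tvar_upd => // w; apply: is_tvar_upd.
  by exists (Contr x x1 x2 M'); first exact: step_contr.
Qed.

(** In the case of a reduct of [M] with the same erasure, the induction hypothesis
    already speaks of the erasure of [M] itself. *)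
Lemma SN_erase M f : wf M -> (forall z, is_tvar (f z)) -> SN M ->
  Acc (fun t' t => beta t t') (erase f M).
Proof.
move=> wM vf snM; elim: snM wM => {}M _ IH wM; constructor=> t b.
have [M' [r wM' _] e] := beta_simulation wM vf b.
have acc := IH M' r wM'.
case: e => e; rewrite e in acc; last exact: acc.
by case: acc => H; apply: (H t b).
Qed.

(** * From typings of the erasure to typings of the term *)

Lemma perm_ty_eq (a b : ty) : perm_eq a b -> ty_eq a b.
Proof.
elim: a b => [|s a IH] b e.
  have -> : b = [::] by apply/perm_nilP; rewrite perm_sym.
  exact: ty_eq_refl.
have sb : s \in b by rewrite -(perm_mem e) mem_head.
case/splitPr: sb e => b1 b2 e.
have /IH e' : perm_eq a (b1 ++ b2).
  by move: e; rewrite -[s :: b2]cat1s perm_sym perm_catCA cat1s perm_cons perm_sym.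
apply: (@ty_eq_trans _ ([:: s] ++ (b1 ++ b2))).
  by rewrite -cat1s; apply: ty_eq_cap e'; apply: ty_eq_refl.
rewrite -[s :: b2]cat1s !catA; apply: ty_eq_cap; last exact: ty_eq_refl.
exact: ty_eq_comm.
Qed.

Definition types_at (x : var) (U : uses var) : ty := [seq u.2 | u <- U & u.1 == x].

(** [D] is a parameter because weakened variables have no use but belong to the
    basis, with the empty intersection. *)
Definition basis_of (D : {fset var}) (U : uses var) : basis :=
  [fmap x : D => types_at (val x) U].

Lemma lookup_fmap (D : {fset var}) (F : var -> ty) x :
  lookup [fmap x : D => F (val x)] x = if x \in D then F x else [::].
Proof.
rewrite /lookup; case: (boolP (x \in D)) => xD; last by rewrite not_fnd.
by rewrite in_fnd ffunE.
Qed.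

Lemma lookup_basis_of D U x : lookup (basis_of D U) x = if x \in D then types_at x U else [::].
Proof. exact: (@lookup_fmap D (fun x => types_at x U) x). Qed.

Lemma lookup_set (G : basis) x a y :
  lookup G.[x <- a] y = if y == x then a else lookup G y.
Proof. by rewrite /lookup fnd_set; case: eqP. Qed.

Lemma lookup_cap G H x : lookup (cap_basis G H) x =
  if x \in domf G then lookup G x ++ lookup H x else [::].
Proof. exact: (@lookup_fmap (domf G) (fun x => lookup G x ++ lookup H x) x). Qed.

Lemma lookup_top G x : lookup (top_basis G) x = [::].
Proof.
have := @lookup_fmap (domf G) (fun _ => [::]) x.
by rewrite if_same.
Qed.

Lemma lookup_cat (G H : basis) x :
  lookup (G + H) x = if x \in domf H then lookup H x else lookup G x.
Proof. by rewrite /lookup fnd_cat; case: ifP. Qed.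

Lemma basis_eqI (G H : basis) : domf G = domf H ->
  (forall x, x \in domf H -> perm_eq (lookup G x) (lookup H x)) -> basis_eq G H.
Proof.
move=> e h; split=> // x; case: (boolP (x \in domf H)) => xH.
  exact/perm_ty_eq/h.
have xG : x \notin domf G by rewrite e.
by rewrite /lookup (not_fnd xG) (not_fnd xH); apply: ty_eq_refl.
Qed.

Lemma typ_basis_eq (G H : basis) M s : typ G M s -> domf G = domf H ->
  (forall x, x \in domf H -> perm_eq (lookup G x) (lookup H x)) -> typ H M s.
Proof.
by move=> t e h; apply: typ_eqv t; [apply: basis_eqI | apply: sty_eq_refl].
Qed.

Lemma types_at_cat x U V : types_at x (U ++ V) = types_at x U ++ types_at x V.
Proof. by rewrite /types_at filter_cat map_cat. Qed.

Lemma types_at_notin x U (A : {fset var}) :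
  {in U, forall u, u.1 \in A} -> x \notin A -> types_at x U = [::].
Proof.
move=> H xA; rewrite /types_at; apply/eqP; rewrite -size_eq0 size_map size_filter.
rewrite -leqn0 leqNgt -has_count; apply/hasPn => u /H uA.
by apply: contraNneq xA => <-.
Qed.

Lemma foldl_cap_basis_of D (B : basis) Us : domf B = D ->
  domf (foldl cap_basis B [seq basis_of D U | U <- Us]) = D /\
  forall x, x \in D ->
    lookup (foldl cap_basis B [seq basis_of D U | U <- Us]) x =
    lookup B x ++ types_at x (flatten Us).
Proof.
elim: Us B => [|U Us IH] B eB /=; first by split=> // x _; rewrite cats0.
have [h1 h2] := IH (cap_basis B (basis_of D U)) eB; split=> // x xD.
by rewrite h2 // lookup_cap eB xD lookup_basis_of xD types_at_cat catA.
Qed.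

Lemma maps_bind x r U :
  perm_eq (maps (upd (fun z => (r z).+1) x 0) U)
          (bind (types_at x U) (maps r [seq u <- U | u.1 != x])).
Proof.
elim: U => [|[y s] U IH] //=; rewrite /bind /types_at /= /upd.
case: (eqVneq y x) => [->|yx] /=; first by rewrite perm_cons.
apply/permP => p; have /permP /(_ p) /= := IH.
by rewrite /bind /= !count_cat /= => ->; rewrite addnCA.
Qed.

Definition types_as (M : term) (U : uses var) (s : sty) : Prop :=
  {in U, forall u, u.1 \in Fv M} /\ typ (basis_of (Fv M) U) M s.

(** The typings of the argument of an application, one for each component of the
    domain, are gathered in a sequence as the application rule requires. *)
Lemma sums_types_as (M : term) (r : var -> nat) G a :
  sums (fun D s => exists2 U, perm_eq D (maps r U) & types_as M U s) G a ->
  exists Us, [/\ size Us = size a,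
    forall i s0, i < size a -> types_as M (nth [::] Us i) (nth s0 a i) &
    perm_eq G (maps r (flatten Us))].
Proof.
elim: a G => [|s a IH] G /=; first by move=> ->; exists [::].
move=> [D [G' [[U e t] /IH [Us [h1 h2 h3]] h4]]].
exists (U :: Us); split; rewrite /= ?h1 //; first by case.
by rewrite (permPl h4) /maps map_cat perm_cat.
Qed.

Lemma map_nth_cons_iota (T : Type) (x0 y : T) (l : seq T) :
  [seq nth x0 (y :: l) i | i <- iota 1 (size l)] = l.
Proof. by rewrite map_nth_iota /= ?subn1 // drop0 take_size. Qed.

(** The context [U0] of the additional typing of the argument only contributes its
    domain to the resulting basis. *)
Lemma typ_app_uses M N U U0 Us a s s0 :
  wf (App M N) -> types_as M U (Arr a s) -> types_as N U0 s0 ->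
  size Us = size a ->
  (forall i s0, i < size a -> types_as N (nth [::] Us i) (nth s0 a i)) ->
  types_as (App M N) (U ++ flatten Us) s.
Proof.
move=> /= /and3P [wM wN dMN] [hU tU] [hU0 tU0] eUs hUs.
have hF : {in flatten Us, forall u, u.1 \in Fv N}.
  move=> u /flattenP [V /(nthP [::]) [i iUs <-]] uV.
  by rewrite eUs in iUs; have [+ _] := hUs i s0 iUs; apply.
split.
  by move=> u; rewrite mem_cat inE => /orP [/hU|/hF] ->; rewrite ?orbT.
(* Index 0 is the additional typing, the others are the components of [a]. *)
pose t i := nth s0 (s0 :: a) i; pose D i := basis_of (Fv N) (nth [::] (U0 :: Us) i).
have et : [seq t i | i <- iota 1 (size a)] = a.
  exact: map_nth_cons_iota.
have eD : [seq D i | i <- iota 1 (size a)] = [seq basis_of (Fv N) V | V <- Us].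
  by rewrite /D (map_comp (basis_of (Fv N)) (nth [::] (U0 :: Us))) -eUs map_nth_cons_iota.
have tD i : i <= size a -> typ (D i) N (t i).
  by case: i => [|i] hi //; have [_] := hUs i s0 hi.
have ta := @typ_app (size a) t (basis_of (Fv M) U) D M N s.
rewrite et eD in ta; have {}ta := ta tU tD (fun _ _ => erefl) dMN.
have [dF lF] := @foldl_cap_basis_of (Fv N) (top_basis (D 0)) Us erefl.
apply: typ_basis_eq ta _ _; first by rewrite domf_cat dF.
move=> x xMN; have {}xMN : x \in Fv (App M N) := xMN.
rewrite lookup_cat dF !lookup_basis_of xMN types_at_cat.
case xN: (x \in Fv N); first rewrite lF // lookup_top.
  rewrite (types_at_notin hU) //; apply/negP => xM.
  by have /fdisjointP /(_ x xM) := dMN; rewrite xN.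
by move: xMN; rewrite /= inE xN orbF => ->; rewrite (types_at_notin hF) ?cats0 ?xN.
Qed.

(** A use of an index in the typing of the erasure comes from one occurrence of one
    variable of [M]; renaming the uses by [r] forgets which.  In the case of a
    contraction, [U] remembers which of [x1] and [x2] each use of [x] belongs to,
    which splits the type of [x] as the contraction rule demands. *)
Lemma typ_of_erasure M r G s : wf M -> has_type (erase (fun x => TVar (r x)) M) G s ->
  exists2 U, perm_eq G (maps r U) & types_as M U s.
Proof.
elim: M r G s => [x|x M IH|M IHM N IHN|x M IH|x x1 x2 M IH] r G s wM.
- move=> ->; exists [:: (x, s)] => //; split=> [u|].
    by rewrite !inE => /eqP ->.
  apply: typ_basis_eq (typ_ax x s) _ _; first by rewrite dom_setf /= fsetU0.
  move=> y; rewrite inE => /eqP ->.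
  by rewrite lookup_set eqxx lookup_basis_of /types_at /= inE eqxx.
- move=> [a [s' [G0 [-> t e]]]]; case/andP: (wM) => wM0 xM.
  have [|U e' [h t']] := IH (upd (fun z => (r z).+1) x 0) G0 s' wM0.
    move: t; congr has_type; apply: eq_erase => z _.
    by rewrite /liftv /upd; case: eqP.
  have /bind_inj [e1 e2] : perm_eq (bind a G)
      (bind (types_at x U) (maps r [seq u <- U | u.1 != x])).
    by rewrite -(permPl e) (permPl e') maps_bind.
  exists [seq u <- U | u.1 != x] => //; split.
    by move=> u; rewrite mem_filter !inE => /andP [-> /h].
  apply: typ_abs; first by rewrite !inE eqxx.
  apply: typ_basis_eq t' _ _; first by rewrite dom_setf /= fsetD1K.
  move=> y; rewrite dom_setf /= fsetD1K // => yM.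
  rewrite lookup_set !lookup_basis_of yM !inE yM andbT.
  case: (eqVneq y x) => [->|yx] /=; first by rewrite perm_sym.
  rewrite /types_at -filter_predI; apply/permP => p; congr (count p _).
  congr map; apply: eq_filter => u /=.
  by case: (eqVneq u.1 y) => [->|].
- move=> [a [G1 [G2 [t1 t2 [G0 [s0 t0]] e]]]].
  have [wM0 wN d] := and3P wM.
  have [U e1 tU] := IHM r G1 (Arr a s) wM0 t1.
  have [U0 _ tU0] := IHN r G0 s0 wN t0.
  have [] := @sums_types_as N r G2 a.
    elim: a G2 t2 {e t1 tU} => //= s' a IH G2 [D [G' [h1 h2 h3]]].
    by exists D, G'; split=> //; [apply: IHN | apply: IH].
  move=> Us [h1 h2 h3]; exists (U ++ flatten Us).
    by rewrite (permPl e) /maps map_cat perm_cat.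
  exact: typ_app_uses wM tU tU0 h1 h2.
- move=> /= t; case/andP: (wM) => wM0 xM.
  have [U e [h t']] := IH r G s wM0 t.
  exists U => //; split; first by move=> u /h uM; rewrite inE uM orbT.
  apply: typ_basis_eq (typ_weak xM t') _ _; first by rewrite dom_setf.
  move=> y /= yM; rewrite lookup_set !lookup_basis_of yM.
  case: (eqVneq y x) => [->|yx]; first by rewrite (types_at_notin h).
  by move: yM; rewrite !inE (negPf yx) /= => ->.
- move=> /= t; have /= /and5P [wM0 x12 x1M x2M xM] := wM.
  have [|U e [h t']] := IH (upd (upd r x1 (r x)) x2 (r x)) G s wM0.
    move: t; congr has_type; apply: eq_erase => z _.
    by rewrite /upd; do 2 case: eqP => //.
  pose c z : var := if (z == x1) || (z == x2) then x else z.
  have cx u : u \in U -> (c u.1 == x) = (u.1 == x1) || (u.1 == x2).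
    move=> /h uM; rewrite /c; case: ifP; rewrite ?eqxx // => e12.
    by apply: contraNF xM => /eqP <-; rewrite !inE e12 uM.
  have cy y u : y != x -> y != x1 -> y != x2 -> (c u == y) = (u == y).
    move=> yx y1 y2; rewrite /c; case: ifP => // /orP [] /eqP ->.
      by rewrite !(eq_sym _ y) (negPf yx) (negPf y1).
    by rewrite !(eq_sym _ y) (negPf yx) (negPf y2).
  exists (maps c U).
    rewrite (permPl e); apply/permP => p; congr (count p _).
    rewrite /maps -map_comp; apply: eq_map => u /=; rewrite /upd /c.
    by case: (u.1 == x2); case: (u.1 == x1).
  split.
    move=> _ /mapP [u uU ->]; rewrite !inE /= cx //.
    by rewrite /c; case: ifP => [_|->]; rewrite ?orbT // (h _ uU) orbT.
  have tc := @typ_contr (basis_of (Fv M `\` [fset x1; x2]) U) x1 x2 x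
    (types_at x1 U) (types_at x2 U) M s _ _ x12 xM.
  have {}tc := tc ltac:(by rewrite !inE eqxx) ltac:(by rewrite !inE eqxx orbT).
  have tu : typ (basis_of (Fv M `\` [fset x1; x2]) U).[x1 <- types_at x1 U]
                  .[x2 <- types_at x2 U] M s.
    apply: typ_basis_eq t' _ _.
      apply/fsetP => z; rewrite !dom_setf /= !inE.
      case: (eqVneq z x2) => [->|z2] //=; case: (eqVneq z x1) => [->|z1] //=.
    move=> z; rewrite !lookup_set !lookup_basis_of.
    rewrite !dom_setf /= !inE.
    case: (eqVneq z x2) => [->|z2] /=; first by rewrite x2M.
    by case: (eqVneq z x1) => [->|z1] /=; first by rewrite x1M.
  apply: typ_basis_eq (tc tu) _ _; first by rewrite dom_setf.
  move=> y /= yM; rewrite lookup_set !lookup_basis_of yM.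
  case: (eqVneq y x) => [->|yx].
    have {cx} : {in U, forall u, (c u.1 == x) = (u.1 == x1) || (u.1 == x2)} := cx.
    elim: (U) => //= u V IHV cx; rewrite /types_at /= cx ?mem_head //.
    have {}IHV := IHV (fun v vV => cx v (mem_behead (s := u :: V) vV)).
    case: (eqVneq u.1 x1) => [->|u1] /=; first by rewrite (negPf x12) perm_cons.
    case: (eqVneq u.1 x2) => [_|u2] //=.
    apply/permP => p; have /permP /(_ p) := IHV.
    by rewrite /types_at /= !count_cat /= addnCA => ->.
  move: yM; rewrite !inE (negPf yx) negb_or /= => /andP [/andP [y1 y2] yM].
  rewrite y1 y2 yM /= /types_at /maps filter_map -map_comp.
  by apply/permP => p; congr (count p _); congr map; apply: eq_filter => u /=; rewrite cy.
Qed.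

Theorem theorem26 (M : term) (wfM : wf M) (snM : SN M) : typeable M.
Proof.
have [G [s t]] := sn_typeable (SN_erase wfM (fun z : var => isT : is_tvar (TVar z)) snM).
have [U _ [_ tU]] := typ_of_erasure (r := id) wfM t.
by exists (basis_of (Fv M) U), s.
Qed.
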